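(* Let $k$ be a field and let $(\Delta,\pi)$ be a balanced simplicial complex of dimension $d-1$ with ordered partition $\pi=(V_1,\dots,V_d)$. If $\tilde{H}_{\operatorname{depth} k[\Delta]-1}(\Delta;k)=0$, then there is an $i\in[d]=\{1,\dots,d\}$ such that $\operatorname{depth} k[\tilde{\Delta}_i]=\operatorname{depth} k[\Delta]-1$.
   Context: Simplicial complexes are finite, contain the empty face $\varnothing$, and contain $\{v\}$ for every vertex $v$. $k[\Delta]$ denotes the Stanley-Reisner ring of $\Delta$ over $k$, and $\operatorname{depth} k[\Delta]$ is its depth as a graded $k$-algebra (with respect to the homogeneous maximal ideal). $\tilde H_i$ is reduced simplicial homology, with $\tilde H_{-1}(\{\varnothing\};k)=k$. A balanced simplicial complex of dimension $d-1$ is a pair $(\Delta,\pi)$ where $\Delta$ is a $(d-1)$-dimensional simplicial complex on vertex set $V$, $\pi=(V_1,\dots,V_d)$ is an ordered partition of $V$, and $|F\cap V_i|\le 1$ for every face $F\in\Delta$ and every $i\in[d]$. For $i\in[d]$, $\tilde\Delta_i=\{\sigma\in\Delta : \sigma\cap V_i=\varnothing\}$ is the subcomplex of $\Delta$ induced on $V\setminus V_i$. *)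

(* Defs.v *)
From HB Require Import structures.
From mathcomp Require Import all_boot all_order all_algebra.
From mathcomp Require Import generic_quotient ring_quotient.
From mathcomp Require boolp classical_sets.
From mathcomp Require Import mpoly.

Set Implicit Arguments.
Unset Strict Implicit.
Unset Printing Implicit Defensive.

Import GRing.Theory.
Local Open Scope ring_scope.

Section Depth.
Variable R : comNzRingType.

(* The ideal (s_0, ..., s_(n-1)) of R. *)
Definition ideal_gen (s : seq R) (x : R) : Prop :=
  exists c : 'I_(size s) -> R, x = \sum_(i < size s) c i * s`_i.

(* Each s_i is a non-zero-divisor on R / (s_0, ..., s_(i-1)), and
   R / (s_0, ..., s_(n-1)) is nonzero. *)
Definition regular_seq (s : seq R) : Prop :=
  (forall i, (i < size s)%N -> forall x,
     ideal_gen (take i s) (s`_i * x) -> ideal_gen (take i s) x) /\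
  ~ ideal_gen s 1.

Definition regular_in (m : R -> Prop) (s : seq R) : Prop :=
  regular_seq s /\ forall x, x \in s -> m x.

Definition is_depth (m : R -> Prop) (n : nat) : Prop :=
  (exists2 s, regular_in m s & size s = n) /\
  (forall s, regular_in m s -> (size s <= n)%N).

(* The maximal length of a regular sequence in m. The default value 0 is taken
   only when these lengths are unbounded, which cannot happen when R is
   Noetherian. The elements of the sequence need not be homogeneous. *)
Definition depth (m : R -> Prop) : nat :=
  classical_sets.xget 0%N (is_depth m).

End Depth.

Record complex (V : finType) := Complex {
  faces :> {set {set V}};
  complex_set0 : set0 \in faces;
  complex_sub : forall F G : {set V}, F \in faces -> G \subset F -> G \in faces;
  complex_set1 : forall v : V, [set v] \in faces
}.

Definition complex_dim (V : finType) (D : complex V) : int :=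
  (\max_(F in faces D) #|F|)%N%:Z - 1.

Section Induced.
Variables (V : finType) (D : complex V) (A : {set V}).

Definition induced_faces : {set {set {v : V | v \in A}}} :=
  [set F : {set {v : V | v \in A}} | val @: F \in faces D].

Fact induced_set0 : set0 \in induced_faces.
Proof. by rewrite inE imset0 complex_set0. Qed.

Fact induced_sub (F G : {set {v : V | v \in A}}) :
  F \in induced_faces -> G \subset F -> G \in induced_faces.
Proof. by rewrite !inE => FD GF; apply: complex_sub FD (imsetS _ GF). Qed.

Fact induced_set1 (v : {v : V | v \in A}) : [set v] \in induced_faces.
Proof. by rewrite inE imset_set1 complex_set1. Qed.

Definition induced : complex {v : V | v \in A} :=
  Complex induced_set0 induced_sub induced_set1.

Lemma inducedE :
  [set val @: (F : {set {v : V | v \in A}}) | F in faces induced]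
  = [set F in faces D | F \subset A].
Proof.
apply/setP=> F; rewrite inE; apply/imsetP/andP => [[G]|[FD FA]].
  rewrite inE => GD ->; split=> //.
  by apply/subsetP=> _ /imsetP[v _ ->]; apply: valP.
have eF : F = val @: [set v : {v : V | v \in A} | val v \in F].
  apply/setP=> v; apply/idP/imsetP => [vF|[w + ->]]; last by rewrite inE.
  by exists (Sub v (subsetP FA v vF)); rewrite ?inE SubK.
by exists [set v : {v : V | v \in A} | val v \in F] => //; rewrite inE -eF.
Qed.

End Induced.

(* The polynomial ring k[x_v : v in V] is {mpoly k[#|V|]}, x_v being the variable
   whose index is the rank of v in the enumeration of V. *)
Section StanleyReisner.
Variables (k : fieldType) (V : finType) (D : complex V).

Definition SR_var (v : V) : {mpoly k[#|V|]} := 'X_(enum_rank v).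

Definition SR_ideal : {pred {mpoly k[#|V|]}} := fun p =>
  boolp.asbool
    (ideal_gen [seq \prod_(v in F) SR_var v | F : {set V} in ~: faces D] p).

Fact SR_ideal_closed : idealr_closed SR_ideal.
Proof.
split.
- apply/boolp.asboolP; exists (fun=> 0).
  by rewrite big1 // => i _; rewrite mul0r.
- apply/boolp.asboolP=> -[c /(congr1 (meval (fun=> 0)))].
  rewrite meval1 raddf_sum big1 => [/eqP|i _]; first by rewrite oner_eq0.
  rewrite /= mevalM; set s := [seq _ | F in _] in c i *.
  have /imageP[F] : s`_i \in s by apply: mem_nth.
  rewrite inE => FD ->; rewrite rmorph_prod /=.
  have /set0Pn[v vF] : F != set0.
    by apply: contraNneq FD => ->; apply: complex_set0.
  by rewrite (bigD1 v) //= mevalXU mul0r mulr0.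
- move=> a p q /boolp.asboolP[c ->] /boolp.asboolP[e ->].
  apply/boolp.asboolP; exists (fun i => a * c i + e i).
  rewrite mulr_sumr -big_split /=.
  by apply: eq_bigr => i _; rewrite mulrDl mulrA.
Qed.

HB.instance Definition _ :=
  isIdealr.Build {mpoly k[#|V|]} SR_ideal SR_ideal_closed.

Definition SR_ring : comNzRingType := {ideal_quot SR_ideal}.

(* The homogeneous maximal ideal of k[D]. *)
Definition SR_max : SR_ring -> Prop :=
  ideal_gen [seq \pi_({ideal_quot SR_ideal})%qT (SR_var v) | v : V].

Definition SR_depth : nat := depth SR_max.

End StanleyReisner.

Section Homology.
Variables (k : fieldType) (V : finType) (D : complex V).

Definition faces_dim (i : int) : {set {set V}} :=
  [set F in faces D | #|F|%:Z == i + 1].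

Definition chains (i : int) : vectType k :=
  {ffun {F : {set V} | F \in faces_dim i} -> k^o}.

(* The coefficient of G in the boundary of F, for the orientation of faces given
   by the enumeration order of V: (-1)^j if G is F without its j-th vertex
   (counting from 0), and 0 if G is not of this form. *)
Definition incidence (F G : {set V}) : k :=
  \sum_(v in F | G == F :\ v)
     (-1) ^+ #|[set u in F | (enum_rank u < enum_rank v)%N]|.

Definition boundary_fun (i j : int) (c : chains i) : chains j :=
  [ffun G => \sum_F c F * incidence (val F) (val G)].

Fact boundary_fun_linear i j : linear (@boundary_fun i j).
Proof.
move=> a c e; apply/ffunP=> G; rewrite !ffunE scaler_sumr -big_split /=.
by apply: eq_bigr => F _; rewrite !ffunE mulrDl -scalerAl.
Qed.

HB.instance Definition _ i j :=
  GRing.isLinear.Build k (chains i) (chains j) _ (@boundary_fun i j)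
    (@boundary_fun_linear i j).

(* Only j = i - 1 is meaningful; keeping j free avoids a cast between
   chains (i + 1 - 1) and chains i. *)
Definition boundary (i j : int) : 'Hom(chains i, chains j) :=
  linfun (@boundary_fun i j).

Definition cycles (i : int) : {vspace chains i} := lker (boundary i (i - 1)).
Definition boundaries (i : int) : {vspace chains i} := limg (boundary (i + 1) i).

Definition is_boundary (i : int) : {pred subvs_of (cycles i)} :=
  fun z => vsval z \in boundaries i.

Fact is_boundary_closed i : zmod_closed (@is_boundary i).
Proof.
split=> [|x y xB yB]; first by rewrite unfold_in /is_boundary linear0 mem0v.
by rewrite unfold_in /is_boundary linearB; apply: rpredB.
Qed.

HB.instance Definition _ i :=
  GRing.isZmodClosed.Build (subvs_of (cycles i)) (@is_boundary i)
    (@is_boundary_closed i).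

Definition reduced_homology (i : int) : zmodType :=
  Quotient.quot (@is_boundary i).

End Homology.

(* The blocks are nonempty; given the other conditions this is automatic, as a
   face with d vertices meets each of the d blocks. *)
Definition balanced (V : finType) (d : nat) (D : complex V)
    (P : 'I_d -> {set V}) : Prop :=
  [/\ complex_dim D = d%:Z - 1,
      injective P,
      partition [set P i | i : 'I_d] [set: V]
    & forall F i, F \in faces D -> (#|F :&: P i| <= 1)%N].

(* Main.v *)
Require Import Defs.
From mathcomp Require Import all_boot all_order all_algebra.
From HB Require Import structures.
From mathcomp Require Import generic_quotient ring_quotient.
From mathcomp Require boolp classical_sets.
From mathcomp Require Import mpoly ring.

(** Let [theta_j] be the sum of the variables of color [j], and let [H_p(D)] be the
    [p]-th Koszul homology of [theta_1, ..., theta_d] on [k[D]]. Then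
    [depth k[D] = d - max {p | H_p(D) <> 0}].

    For the upper bound, dividing by a regular element of the maximal ideal shifts the
    top non-vanishing Koszul homology by at least one, because every [x_v ^ 2] lies in
    the ideal of the [theta_j] and so kills homology. For the lower bound, if
    [H_p(D) = 0] for [p > d - t], then the elementary symmetric polynomials
    [e_1(theta), ..., e_t(theta)] form a regular sequence: removing the facets [F] with
    more than [t] vertices one at a time (the colon ideals are those of simplices)
    reduces this to complexes whose faces have at most [t] vertices, where the
    [theta_j] are nilpotent modulo [e_1, ..., e_t] by Vieta's formula.

    Now let [p] be maximal with [H_p(D) <> 0]. A class splits into the parts whose
    monomials avoid color [i], which come from the complex induced on the other colors,
    and a part supported on squarefree monomials involving every color that the Koszul
    degree allows. The latter is a cochain complex of [D], and it is exact in the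
    relevant degree by hypothesis. So [H_p] is non-zero for some induced complex, and
    the depth formula applied to that complex gives the result. *)

Set Implicit Arguments.
Unset Strict Implicit.
Unset Printing Implicit Defensive.

Import GRing.Theory.
Local Open Scope ring_scope.

(** * Ideals as predicates; colon ideals and adjunction of an element *)

Definition is_ideal (R : comNzRingType) (J : R -> Prop) : Prop :=
  J 0 /\ forall a x y, J x -> J y -> J (a * x + y).

Definition colon (R : comNzRingType) (J : R -> Prop) (a : R) : R -> Prop :=
  fun x => J (a * x).

Definition adjoin (R : comNzRingType) (J : R -> Prop) (a : R) : R -> Prop :=
  fun x => exists y, J (x - a * y).

Section Ideals.
Variables (R : comNzRingType) (J : R -> Prop).
Hypothesis idJ : is_ideal J.

Lemma ideal0 : J 0. Proof. by case: idJ. Qed.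

Lemma idealD x y : J x -> J y -> J (x + y).
Proof. by case: idJ => _ cl Jx Jy; rewrite -[x]mul1r; apply: cl. Qed.

Lemma idealM a x : J x -> J (a * x).
Proof. by case: idJ => J0 cl Jx; rewrite -[a * x]addr0; apply: cl. Qed.

Lemma idealN x : J x -> J (- x).
Proof. by rewrite -mulN1r; apply: idealM. Qed.

Lemma idealB x y : J x -> J y -> J (x - y).
Proof. by move=> Jx Jy; apply: idealD => //; apply: idealN. Qed.

Lemma ideal_sum (A : Type) (r : seq A) (P : pred A) F :
  (forall i, P i -> J (F i)) -> J (\sum_(i <- r | P i) F i).
Proof. by move=> JF; apply: (big_ind J) => //; [exact: ideal0 | exact: idealD]. Qed.

Lemma colon_ideal a : is_ideal (colon J a).
Proof.
split=> [|b x y]; rewrite /colon; first by rewrite mulr0; apply: ideal0.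
by move=> Jx Jy; rewrite mulrDr mulrCA; apply: idealD Jy; apply: idealM.
Qed.

Lemma adjoin_ideal a : is_ideal (adjoin J a).
Proof.
split; first by exists 0; rewrite mulr0 subr0; apply: ideal0.
move=> b x y [x' Jx] [y' Jy]; exists (b * x' + y').
have -> : b * x + y - a * (b * x' + y') = b * (x - a * x') + (y - a * y').
  by rewrite mulrDr mulrBr opprD addrACA (mulrCA a).
by apply: idealD Jy; apply: idealM.
Qed.

Lemma adjoin_sub a x : J x -> adjoin J a x.
Proof. by exists 0; rewrite mulr0 subr0. Qed.

Lemma adjoin_gen a b : adjoin J a (a * b).
Proof. by exists b; rewrite subrr; apply: ideal0. Qed.

End Ideals.

(** * The Koszul complex: signs, contraction, exterior multiplication, differential *)

Lemma sign_swap (R : comNzRingType) (x y z e : R) :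
  y * (e * z * x) = - (z * (- e * y * x)).
Proof. by ring. Qed.

Lemma sign_cancel (R : comNzRingType) (x y z e : R) :
  e * e = 1 -> - e * x * (e * z * y) = - (z * (x * y)).
Proof. by move=> e1; rewrite -[z in RHS]mul1r -e1; ring. Qed.

Section Koszul.
Variables (R : comNzRingType) (I : finType).
Implicit Types (i j a : I) (T X Y : {set I}) (p q : nat).

(** One type serves all degrees, all subsequences [X] and all quotients of [R]: degree and support
    are imposed by [kin], and equations over [R / J] are read modulo [J] through [inJ], so no
    quotient module is formed. *)
Definition kchain : zmodType := {ffun {set I} -> R}.
Implicit Types f g u w : kchain.

Definition kscale (b : R) f : kchain := [ffun T : {set I} => b * f T].

Fact kscale_zmod b : zmod_morphism (kscale b).
Proof. by move=> f g; apply/ffunP=> T; rewrite !ffunE mulrBr. Qed.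

HB.instance Definition _ b := GRing.isZmodMorphism.Build kchain kchain (kscale b) (kscale_zmod b).

Local Infix "*k" := kscale (at level 40).

Definition koszul_sign i T : R :=
  (-1) ^+ #|[set j in T | (enum_rank j < enum_rank i)%N]|.

(* With [f T] the coefficient of the basis vector [e_T] of the exterior algebra, [ann i]
   and [cre i] are contraction with and multiplication by [e_i]. *)
Definition ann i f : kchain :=
  [ffun T : {set I} => if i \in T then 0 else koszul_sign i T * f (i |: T)].

Definition cre i f : kchain :=
  [ffun T : {set I} => if i \in T then koszul_sign i T * f (T :\ i) else 0].

Fact ann_zmod i : zmod_morphism (ann i).
Proof.
by move=> f g; apply/ffunP=> T; rewrite !ffunE; case: ifP; rewrite ?subrr ?mulrBr.
Qed.

HB.instance Definition _ i := GRing.isZmodMorphism.Build kchain kchain (ann i) (ann_zmod i).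

Fact cre_zmod i : zmod_morphism (cre i).
Proof.
by move=> f g; apply/ffunP=> T; rewrite !ffunE; case: ifP; rewrite ?subrr ?mulrBr.
Qed.

HB.instance Definition _ i := GRing.isZmodMorphism.Build kchain kchain (cre i) (cre_zmod i).

Lemma ann_scale i b f : ann i (b *k f) = b *k ann i f.
Proof. by apply/ffunP=> T; rewrite !ffunE; case: ifP; rewrite ?mulr0 1?mulrCA. Qed.

Lemma cre_scale i b f : cre i (b *k f) = b *k cre i f.
Proof. by apply/ffunP=> T; rewrite !ffunE; case: ifP; rewrite ?mulr0 1?mulrCA. Qed.

Lemma koszul_signU1 i j T : j \notin T ->
  koszul_sign i (j |: T) =
  (-1) ^+ (enum_rank j < enum_rank i)%N * koszul_sign i T.
Proof.
move=> jT; rewrite /koszul_sign -exprD; congr (_ ^+ _).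
rewrite (cardsD1 j) !inE eqxx /=; congr (_ + _)%N; apply: eq_card => x.
by rewrite !inE; case: (eqVneq x j) => [->|] //=; rewrite (negPf jT).
Qed.

Lemma koszul_signD1 i T : koszul_sign i (T :\ i) = koszul_sign i T.
Proof.
rewrite /koszul_sign; congr (_ ^+ _); apply: eq_card => x.
by rewrite !inE; case: (eqVneq x i) => [->|] //=; rewrite ltnn andbF.
Qed.

Lemma koszul_sign_sqr i T : koszul_sign i T * koszul_sign i T = 1.
Proof. by rewrite /koszul_sign -expr2 sqrr_sign. Qed.

Lemma koszul_sign_neq i j :
  i != j ->
  (-1) ^+ (enum_rank j < enum_rank i)%N =
  - (-1) ^+ (enum_rank i < enum_rank j)%N :> R.
Proof.
move=> ij; case: ltngtP; rewrite ?opprK // => /ord_inj /enum_rank_inj eij.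
by rewrite eij eqxx in ij.
Qed.

Lemma annC i j f : ann i (ann j f) = - ann j (ann i f).
Proof.
apply/ffunP=> T; rewrite !ffunE !inE.
have [->|ij] := eqVneq i j; first by case: (j \in T); rewrite ?mulr0 oppr0.
rewrite /=.
case: ifP => iT; case: ifP => jT; rewrite ?mulr0 ?oppr0 //.
rewrite !koszul_signU1 ?iT ?jT // (koszul_sign_neq ij) setUCA.
exact: sign_swap.
Qed.

Lemma annK i f : ann i (ann i f) = 0.
Proof. by apply/ffunP=> T; rewrite !ffunE !inE eqxx /= mulr0; case: ifP. Qed.

Lemma ann_cre i f : ann i (cre i f) = f - cre i (ann i f).
Proof.
apply/ffunP=> T; rewrite !ffunE !inE eqxx /=.
case: ifP => iT.
  by rewrite koszul_signD1 mulrA koszul_sign_sqr mul1r setD1K ?subrr.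
by rewrite subr0 -(koszul_signD1 i (i |: T)) setU1K ?iT // mulrA koszul_sign_sqr mul1r.
Qed.

Lemma ann_creE i f T : ann i (cre i f) T = if i \in T then 0 else f T.
Proof.
rewrite !ffunE setU11; case: ifPn => // iT.
by rewrite mulrA -(koszul_signD1 i (i |: T)) setU1K // koszul_sign_sqr mul1r.
Qed.

Lemma ann_creC i j f : i != j -> ann i (cre j f) = - cre j (ann i f).
Proof.
move=> ij; apply/ffunP=> T; rewrite !ffunE !inE (eq_sym j i) (negPf ij) /=.
case: (boolP (i \in T)) => iT; case: (boolP (j \in T)) => jT; rewrite ?mulr0 ?oppr0 //.
have TE : T = j |: (T :\ j) by rewrite setD1K.
have -> : (i |: T) :\ j = i |: T :\ j.
  by apply/setP=> x; rewrite !inE; case: (eqVneq x j) => [->|] //=; rewrite eq_sym (negPf ij).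
rewrite koszul_signU1 // -(koszul_signD1 j T).
rewrite {1}TE koszul_signU1; last by rewrite !inE eqxx.
rewrite (koszul_sign_neq ij).
by apply: sign_cancel; rewrite -expr2 sqrr_sign.
Qed.

Variable s : I -> R.

Definition kdiff X f : kchain := \sum_(i in X) s i *k ann i f.

Fact kdiff_zmod X : zmod_morphism (kdiff X).
Proof.
by move=> f g; rewrite /kdiff -sumrB; apply: eq_bigr => i _; rewrite !raddfB.
Qed.

HB.instance Definition _ X := GRing.isZmodMorphism.Build kchain kchain (kdiff X) (kdiff_zmod X).

Lemma kdiffE X f T : kdiff X f T = \sum_(i in X) s i * ann i f T.
Proof. by rewrite /kdiff sum_ffunE; apply: eq_bigr => i _; rewrite ffunE. Qed.

Lemma kdiff_scale X b f : kdiff X (b *k f) = b *k kdiff X f.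
Proof.
rewrite /kdiff raddf_sum; apply: eq_bigr => i _.
by rewrite ann_scale; apply/ffunP=> T; rewrite !ffunE mulrCA.
Qed.

Lemma kdiffU1 a X f : a \notin X -> kdiff (a |: X) f = s a *k ann a f + kdiff X f.
Proof. by move=> aX; rewrite /kdiff big_setU1. Qed.

Lemma kdiff_ann X i f : kdiff X (ann i f) = - ann i (kdiff X f).
Proof.
rewrite /kdiff raddf_sum -sumrN; apply: eq_bigr => j _.
by rewrite /= annC ann_scale raddfN.
Qed.

Lemma kdiff_creC X i f : i \notin X -> kdiff X (cre i f) = - cre i (kdiff X f).
Proof.
move=> iX; rewrite /kdiff raddf_sum -sumrN; apply: eq_bigr => j jX.
have ji : j != i by apply: contraNneq iX => <-.
by rewrite /= ann_creC // cre_scale raddfN.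
Qed.

(** [cre i] is a null-homotopy of multiplication by [s i], since it anticommutes with [ann j] for
    [j != i] while [ann i] and [cre i] compose both ways to a sum equal to the identity. Hence each
    [s i] kills Koszul homology. *)
Lemma kdiff_cre X i f : i \in X -> kdiff X (cre i f) = s i *k f - cre i (kdiff X f).
Proof.
move=> iX; rewrite -(setD1K iX) !kdiffU1 ?setD11 //.
rewrite kdiff_creC ?setD11 // ann_cre raddfB /= [cre i (_ + _)]raddfD /= cre_scale.
by rewrite opprD addrA.
Qed.

Lemma kdiffK X f : kdiff X (kdiff X f) = 0.
Proof.
have [n] := ubnP #|X|; elim: n X f => // n IH X f.
have [->|/set0Pn[a aX]] := eqVneq X set0; first by rewrite /kdiff !big_set0.
rewrite (cardsD1 a) aX => /IH {}IH.
rewrite -(setD1K aX) !kdiffU1 ?setD11 // !raddfD /= IH ann_scale kdiff_scale annK.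
by rewrite kdiff_ann !raddf0 add0r addr0 raddfN subrr.
Qed.

Definition kin X p f := forall T, ~~ ((T \subset X) && (#|T| == p)) -> f T = 0.

Lemma kin_add X p f g : kin X p f -> kin X p g -> kin X p (f + g).
Proof. by move=> Kf Kg T nT; rewrite ffunE Kf ?Kg ?addr0. Qed.

Lemma kin_scale X p b f : kin X p f -> kin X p (b *k f).
Proof. by move=> Kf T nT; rewrite ffunE Kf ?mulr0. Qed.

Lemma kin_opp X p f : kin X p f -> kin X p (- f).
Proof. by move=> Kf T nT; rewrite ffunE Kf ?oppr0. Qed.

Lemma kin_sub X p f g : kin X p f -> kin X p g -> kin X p (f - g).
Proof. by move=> Kf Kg; apply/kin_add/kin_opp. Qed.

Lemma kinW X Y p f : X \subset Y -> kin X p f -> kin Y p f.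
Proof.
move=> XY Kf T nT; apply: Kf; apply: contra nT => /andP[TX ->].
by rewrite (subset_trans TX XY).
Qed.

Lemma kin_ann X i p f : kin X p.+1 f -> kin (X :\ i) p (ann i f).
Proof.
move=> Kf T nT; rewrite ffunE; case: ifP => iT //; rewrite Kf ?mulr0 //.
apply: contra nT => /andP[]; rewrite cardsU1 iT eqSS => TX ->; rewrite andbT.
by rewrite subsetD1 iT andbT; apply: subset_trans (subsetUr _ _) TX.
Qed.

Lemma ann_kin0 X i f : kin X 0 f -> ann i f = 0.
Proof.
move=> Kf; apply/ffunP=> T; rewrite !ffunE; case: ifP => iT //; rewrite Kf ?mulr0 //.
by rewrite cardsU1 iT andbF.
Qed.

Lemma kin_cre X i p f : kin X p f -> kin (i |: X) p.+1 (cre i f).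
Proof.
move=> Kf T nT; rewrite ffunE; case: ifP => iT //; rewrite Kf ?mulr0 //.
apply: contra nT => /andP[TX Tp]; rewrite [#|T|](cardsD1 i) iT eqSS Tp andbT.
by rewrite -subDset.
Qed.

Lemma kin_cre_in X i p f : i \in X -> kin X p f -> kin X p.+1 (cre i f).
Proof. by move=> iX /(@kin_cre X i); rewrite setUC (setUidPl _) ?sub1set. Qed.

Lemma kin_diff X p f : kin X p.+1 f -> kin X p (kdiff X f).
Proof.
move=> Kf T nT; rewrite kdiffE big1 // => i iX.
by rewrite (kinW (subD1set X i) (kin_ann Kf)) ?mulr0.
Qed.

Lemma kdiff_kin0 X f : kin X 0 f -> kdiff X f = 0.
Proof. by move=> Kf; rewrite /kdiff big1 // => i _; rewrite (ann_kin0 _ Kf) raddf0. Qed.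

Lemma ann_notin a X p f : a \notin X -> kin X p f -> ann a f = 0.
Proof.
move=> aX Kf; apply/ffunP=> T; rewrite !ffunE; case: ifP => iT //; rewrite Kf ?mulr0 //.
by rewrite subUset sub1set (negPf aX).
Qed.

(* A chain on [a |: X] is [f = u + cre a w] with [u], [w] chains on [X], where
   [w = ann a f]. *)
Lemma kin_split a X p f : a \notin X -> kin (a |: X) p f ->
  kin X p (f - cre a (ann a f)).
Proof.
move=> aX Kf T nT; rewrite !ffunE setD11.
case: ifP => aT.
  by rewrite mulrA -{1}(koszul_signD1 a T) koszul_sign_sqr mul1r setD1K ?subrr.
rewrite subr0 Kf //; apply: contra nT => /andP[TX ->]; rewrite andbT.
apply/subsetP=> x xT; move: (subsetP TX x xT); rewrite !inE.
by case: eqP => // xa; rewrite xa aT in xT.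
Qed.

(** * Koszul homology modulo an ideal and its long exact sequences *)

Section Homology.
Variable J : R -> Prop.
Hypothesis idJ : is_ideal J.

Definition inJ f := forall T, J (f T).

Lemma inJ0 : inJ 0. Proof. by move=> T; rewrite ffunE; apply: ideal0. Qed.
Lemma inJD f g : inJ f -> inJ g -> inJ (f + g).
Proof. by move=> Jf Jg T; rewrite ffunE; apply: idealD. Qed.
Lemma inJZ b f : inJ f -> inJ (b *k f).
Proof. by move=> Jf T; rewrite ffunE; apply: idealM. Qed.
Lemma inJN f : inJ f -> inJ (- f).
Proof. by move=> Jf T; rewrite ffunE; apply: idealN. Qed.
Lemma inJB f g : inJ f -> inJ g -> inJ (f - g).
Proof. by move=> Jf Jg; apply/inJD/inJN. Qed.
Lemma inJ_ann i f : inJ f -> inJ (ann i f).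
Proof. by move=> Jf T; rewrite ffunE; case: ifP => _; [apply: ideal0|apply: idealM]. Qed.
Lemma inJ_cre i f : inJ f -> inJ (cre i f).
Proof. by move=> Jf T; rewrite ffunE; case: ifP => _; [apply: idealM|apply: ideal0]. Qed.
Lemma inJ_diff X f : inJ f -> inJ (kdiff X f).
Proof.
move=> Jf T; rewrite kdiffE; apply: ideal_sum => // i _.
exact/(idealM idJ)/(inJ_ann i Jf).
Qed.

End Homology.

(** The witness carries no condition on degree or support, which keeps closure properties immediate;
    [bnd_kin] restores both. *)
Definition bnd X J f := exists g, inJ J (f - kdiff X g).

(* The [p]-th Koszul homology of the [s i], [i] in [X], on [R / J] vanishes. *)
Definition exact X J p := forall f, kin X p f -> inJ J (kdiff X f) -> bnd X J f.

Lemma subset_congr_kdiff X f g T : T \subset X ->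
  (forall i, i \in X -> i \notin T -> f (i |: T) = g (i |: T)) ->
  kdiff X f T = kdiff X g T.
Proof.
move=> TX fg; rewrite !kdiffE; apply: eq_bigr => i iX; congr (_ * _).
by rewrite !ffunE; case: ifP => // /negbT iT; rewrite fg.
Qed.

(** Only the coefficients of [g] at the subsets of [X] of size [p.+1] enter those of [kdiff X g] at
    the subsets of size [p], so [g] can be cut down to them. *)
Lemma bnd_kin X J p f : is_ideal J -> kin X p f -> bnd X J f ->
  exists g, kin X p.+1 g /\ inJ J (f - kdiff X g).
Proof.
move=> idJ Kf [g Jg].
pose g' : kchain :=
  [ffun T : {set I} => if (T \subset X) && (#|T| == p.+1) then g T else 0].
have Kg' : kin X p.+1 g' by move=> T /negPf nT; rewrite ffunE nT.
exists g'; split=> // T; have [/andP[TX /eqP Tp]|nT] := boolP ((T \subset X) && (#|T| == p)).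
  have := Jg T; rewrite !ffunE (@subset_congr_kdiff X g g') // => i iX iT.
  by rewrite ffunE subUset sub1set iX TX cardsU1 iT Tp eqxx.
by rewrite !ffunE Kf // (kin_diff Kg') // subrr; apply: ideal0.
Qed.

Ltac kring :=
  repeat match goal with
  | |- context [kdiff ?X ?f] => move: (kdiff X f) => ?
  | |- context [cre ?i ?f] => move: (cre i f) => ?
  | |- context [ann ?i ?f] => move: (ann i f) => ?
  end;
  apply/ffunP=> ?; rewrite !ffunE; ring.

(** The complex on [a |: X] is the mapping cone of [s a] acting on the complex on [X], so its
    homology in degree [p.+1] sits between H_(p+1) and H_p of [X]. *)
Lemma exact_add a X J p : is_ideal J -> a \notin X ->
  exact X J p -> exact X J p.+1 -> exact (a |: X) J p.+1.
Proof.
move=> idJ aX ex0 ex1 f Kf; rewrite kdiffU1 // => Jf.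
pose w := ann a f; pose u := f - cre a w.
have Ku : kin X p.+1 u by apply: kin_split.
have Kw : kin X p w by have := kin_ann (i := a) Kf; rewrite setU1K.
have Jw : inJ J (kdiff X w).
  have := inJ_ann idJ a Jf.
  rewrite raddfD /= ann_scale annK raddf0 add0r -[ann a _]opprK -kdiff_ann.
  by move/(inJN idJ); rewrite opprK.
have [g [Kg Jg]] := bnd_kin idJ Kw (ex0 w Kw Jw).
pose h := u + s a *k g.
(* Since [w] is the boundary of [g] modulo [J], adding [s a *k g] to [u] turns it into a cycle on
   [X]. *)
have Kh : kin X p.+1 h by apply/kin_add/kin_scale.
have [|k [Kk Jk]] := bnd_kin idJ Kh (ex1 h Kh _).
  have -> : kdiff X h = (s a *k ann a f + kdiff X f) + cre a (kdiff X w)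
                          - s a *k (w - kdiff X g).
    rewrite /h /u raddfD raddfB /= kdiff_scale kdiff_creC // /w; kring.
  apply: inJB (inJZ _ _ Jg) => //; apply: inJD => //; exact: inJ_cre.
exists (k - cre a g).
have -> : f - kdiff (a |: X) (k - cre a g) = (h - kdiff X k) + cre a (w - kdiff X g).
  rewrite raddfB /= kdiff_cre ?setU11 // !kdiffU1 // (ann_notin aX Kk) (ann_notin aX Kg).
  rewrite !raddf0 !add0r /h /u [cre a (_ - _)]raddfB /= /w; kring.
by apply: inJD => //; apply: inJ_cre.
Qed.

Lemma kscaleK b c f : b *k (c *k f) = (b * c) *k f.
Proof. by apply/ffunP=> T; rewrite !ffunE mulrA. Qed.

(** This is the annihilator of the class of [f]. It is the ideal to which statements about all
    ideals containing [J] and the [s i] are applied below. *)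
Lemma bnd_ideal X J f : is_ideal J -> is_ideal (fun x => bnd X J (x *k f)).
Proof.
move=> idJ; split.
  exists 0; rewrite raddf0 subr0 => T; rewrite ffunE mul0r; exact: ideal0.
move=> b x y [g Jg] [h Jh]; exists (b *k g + h).
have -> : (b * x + y) *k f - kdiff X (b *k g + h) =
          b *k (x *k f - kdiff X g) + (y *k f - kdiff X h).
  by rewrite raddfD /= kdiff_scale; kring.
by apply: inJD => //; apply: inJZ.
Qed.

Lemma bnd_inJ X J f : is_ideal J -> inJ J f -> bnd X J f.
Proof. by move=> idJ Jf; exists 0; rewrite raddf0 subr0. Qed.

Lemma bndD X J f g : is_ideal J -> bnd X J f -> bnd X J g -> bnd X J (f + g).
Proof.
move=> idJ [h Jh] [k Jk]; exists (h + k).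
by rewrite raddfD /= opprD addrACA; apply: inJD.
Qed.

Lemma bnd_scale_J X J f x : is_ideal J -> J x -> bnd X J (x *k f).
Proof. by move=> idJ Jx; apply: bnd_inJ => // T; rewrite ffunE mulrC; apply: idealM. Qed.

Lemma bnd_scale_gen X J f i : is_ideal J -> i \in X -> inJ J (kdiff X f) ->
  bnd X J (s i *k f).
Proof.
move=> idJ iX Jf; exists (cre i f).
by rewrite kdiff_cre // opprB addrC subrK; apply: inJ_cre.
Qed.

Lemma kscale1 f : 1 *k f = f.
Proof. by apply/ffunP=> T; rewrite ffunE mul1r. Qed.

Lemma inJ_kdiff_scale X J b f : is_ideal J ->
  inJ J (kdiff X f) -> inJ J (kdiff X (b *k f)).
Proof. by move=> idJ Jf; rewrite kdiff_scale; apply: inJZ. Qed.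

(** In the cone sequence, vanishing of H_(q+1) on [a |: X] makes [s a] injective on H_q of [X]: if
    [s a *k w] is the boundary of [g], then [cre a w - g] is a cycle, and contracting with [a] a
    chain that bounds it gives, up to sign, one that bounds [w]. *)
Lemma exact_inj a X J q w : is_ideal J -> a \notin X -> exact (a |: X) J q.+1 ->
  kin X q w -> inJ J (kdiff X w) -> bnd X J (s a *k w) -> bnd X J w.
Proof.
move=> idJ aX ex Kw Jw /(bnd_kin idJ (kin_scale (s a) Kw))[g [Kg Jg]].
have [||k Jk] := ex (cre a w - g).
- apply: kin_sub; first exact: kin_cre.
  by apply: kinW Kg; apply: subsetUr.
- rewrite raddfB /= kdiff_cre ?setU11 // !kdiffU1 // (ann_notin aX Kg) (ann_notin aX Kw).
  rewrite !raddf0 !add0r addrAC; apply: inJB => //; exact: inJ_cre.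
exists (- ann a k); have := inJ_ann idJ a Jk.
rewrite !raddfB /= ann_cre (ann_notin aX Kw) (ann_notin aX Kg) raddf0 !subr0.
by rewrite -kdiff_ann kdiffU1 // annK raddf0 add0r raddfN opprK.
Qed.

(** The same sequence one step further: vanishing of H_q on [a |: X] makes [s a] surjective on H_q
    of [X]. The preimage [v] is the contraction with [a] of a chain bounding [w]. *)
Lemma exact_decomp a X J q w : is_ideal J -> a \notin X -> exact (a |: X) J q ->
  kin X q w -> inJ J (kdiff X w) ->
  exists u v, [/\ kin X q v, inJ J (kdiff X v) & inJ J (w - kdiff X u - s a *k v)].
Proof.
move=> idJ aX ex Kw Jw.
have KXw : kin (a |: X) q w by apply: kinW Kw; apply: subsetUr.
have [|g [Kg Jg]] := bnd_kin idJ KXw.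
  by apply: ex => //; rewrite kdiffU1 // (ann_notin aX Kw) raddf0 add0r.
pose v := ann a g; have Kv : kin X q v by have := kin_ann (i := a) Kg; rewrite setU1K.
have Jv : inJ J (kdiff X v).
  have := inJ_ann idJ a Jg.
  by rewrite raddfB /= (ann_notin aX Kw) -kdiff_ann add0r kdiffU1 // annK raddf0 add0r.
exists (g - cre a v), v; split=> //.
have -> : w - kdiff X (g - cre a v) - s a *k v = (w - kdiff (a |: X) g) - cre a (kdiff X v).
  by rewrite raddfB /= kdiff_creC // kdiffU1 // -/v; move: (s a *k v) => ?; kring.
by apply: inJB => //; apply: inJ_cre.
Qed.

(** The homotopy is [cre i] composed with [rho]. The terms in [s j], [j != i], cancel because [rho]
    commutes with them, so only the two products with [s i] remain. *)
Lemma exact_homotopy i X J (rho : {additive R -> R}) f : is_ideal J -> i \in X ->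
  (forall x, J x -> J (rho x)) ->
  (forall j x, j \in X -> j != i -> rho (s j * x) = s j * rho x) ->
  inJ J (kdiff X f) ->
  bnd X J [ffun T : {set I} => if i \in T then rho (s i * f T) else s i * rho (f T)].
Proof.
move=> idJ iX Jrho rhoC Jf.
pose rf : kchain := [ffun T : {set I} => rho (f T)].
pose rd : kchain := [ffun T : {set I} => rho (kdiff X f T)].
have Jrd : inJ J rd by move=> T; rewrite ffunE; apply: Jrho.
have ann_rho j T : ann j rf T = rho (ann j f T).
  by rewrite !ffunE; case: ifP; rewrite ?raddf0 // raddfMsign.
exists (cre i rf); set Q := [ffun T : {set I} => _].
suff -> : Q - kdiff X (cre i rf) = cre i rd by apply: inJ_cre.
apply/eqP; rewrite subr_eq kdiff_cre // addrCA -raddfB /=; apply/eqP/ffunP=> T.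
rewrite !ffunE -/(kchain) !kdiffE (bigD1 i) //= [X in _ - X](bigD1 i) //= ann_rho raddfD.
have -> : rho (\sum_(j in X | j != i) s j * ann j f (T :\ i)) =
          \sum_(j in X | j != i) s j * ann j rf (T :\ i).
  by rewrite raddf_sum; apply: eq_bigr => j /andP[jX ji]; rewrite /= ann_rho rhoC.
rewrite opprD addrACA subrr addr0; case: ifP => iT; last by rewrite addr0.
rewrite !ffunE setD11 koszul_signD1 setD1K // mulrCA !raddfMsign mulrCA -mulrBr mulrA.
by rewrite -expr2 sqrr_sign mul1r addrCA subrr addr0.
Qed.

Lemma inJ_adjoin X J (a : R) p f : is_ideal J -> kin X p f -> inJ (adjoin J a) f ->
  exists k, kin X p k /\ inJ J (f - a *k k).
Proof.
move=> idJ Kf /fin_all_exists[k Jk].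
exists [ffun T : {set I} => if (T \subset X) && (#|T| == p) then k T else 0]; split.
  by move=> T /negPf nT; rewrite ffunE nT.
move=> T; rewrite !ffunE; case: ifPn => [_|nT]; first exact: Jk.
by rewrite Kf // mulr0 subrr; apply: ideal0.
Qed.

Lemma inJ_adjoin_sub J (a : R) f k : is_ideal J -> inJ J (f - a *k k) -> inJ (adjoin J a) f.
Proof. by move=> idJ Jf T; exists (k T); have := Jf T; rewrite !ffunE. Qed.

(** This is injectivity of [a] in the long exact sequence of multiplication by [a] on [R / J]. If
    [a *k f] is the boundary of [g], then [g] is a cycle modulo [a], so it is a boundary plus
    [a *k k]; cancelling [a] shows that [k] bounds [f]. *)
Lemma exact_regular (a : R) X J p f : is_ideal J -> (forall x, J (a * x) -> J x) ->
  exact X (adjoin J a) p.+1 -> kin X p f -> inJ J (kdiff X f) ->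
  bnd X J (a *k f) -> bnd X J f.
Proof.
move=> idJ reg ex Kf Jf /(bnd_kin idJ (kin_scale a Kf))[g [Kg Jg]].
have idA := adjoin_ideal idJ a.
have [|h [Kh Jh]] := bnd_kin idA Kg (ex g Kg _).
  apply: (@inJ_adjoin_sub _ _ _ f) => //; have := inJN idJ Jg; by rewrite opprB.
have [k [Kk Jk]] := inJ_adjoin idJ (kin_sub Kg (kin_diff Kh)) Jh.
exists k => T; rewrite !ffunE; apply: reg.
have := inJ_diff idJ X Jk; rewrite !raddfB /= kdiffK subr0 kdiff_scale => Jk'.
have := inJD idJ Jg Jk' T; rewrite !ffunE addrA subrK.
by rewrite mulrBr.
Qed.

(** Multiplication by [a] gives a short exact sequence from [R / (J : a)] through [R / J] to
    [R / (J + a)]; this is the middle term of its homology sequence. *)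
Lemma exact_colon_adjoin (a : R) X J q : is_ideal J ->
  exact X (colon J a) q -> exact X (adjoin J a) q -> exact X J q.
Proof.
move=> idJ exC exA f Kf Jf.
have idA := adjoin_ideal idJ a; have idC := colon_ideal idJ a.
have [|g [Kg Jg]] := bnd_kin idA Kf (exA f Kf _).
  by move=> T; apply: adjoin_sub.
have [k [Kk Jk]] := inJ_adjoin idJ (kin_sub Kf (kin_diff Kg)) Jg.
have [|l Jl] := exC k Kk.
  move=> T; have := inJB idJ Jf (inJ_diff idJ X Jk).
  rewrite !(raddfB (kdiff X)) /= kdiffK subr0 kdiff_scale opprB addrC subrK.
  by move/(_ T); rewrite ffunE.
exists (g + a *k l).
have Jal : inJ J (a *k (k - kdiff X l)) by move=> T; rewrite ffunE; apply: Jl.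
have := inJD idJ Jk Jal; rewrite raddfB /= addrA subrK -kdiff_scale.
by rewrite raddfD /= opprD addrA.
Qed.

(** In the same homology sequence, H_(p+1) of [R / (J + a)] sits between H_(p+1) of [R / J] and H_p
    of [R / (J : a)]. *)
Lemma exact_adjoin (a : R) X J p : is_ideal J ->
  exact X J p.+1 -> exact X (colon J a) p -> exact X (adjoin J a) p.+1.
Proof.
move=> idJ ex exC f Kf Jf; have idC := colon_ideal idJ a.
have [h [Kh Jh]] := inJ_adjoin idJ (kin_diff Kf) Jf.
have [|g [Kg Jg]] := bnd_kin idC Kh (exC h Kh _).
  move=> T; have := inJN idJ (inJ_diff idJ X Jh).
  by rewrite raddfB /= kdiffK sub0r opprK kdiff_scale => /(_ T); rewrite ffunE.
have [||k Jk] := ex (f - a *k g); first by apply/kin_sub/kin_scale.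
  have Jal : inJ J (a *k (h - kdiff X g)) by move=> T; rewrite ffunE; apply: Jg.
  by have := inJD idJ Jh Jal; rewrite raddfB /= addrA subrK raddfB /= kdiff_scale.
exists k; apply: (@inJ_adjoin_sub _ _ _ g) => //.
by move: Jk; rewrite addrAC.
Qed.

Lemma exact_iff X J J' p : (forall x, J x <-> J' x) -> exact X J p -> exact X J' p.
Proof.
move=> JJ' ex f Kf Jf; have [|g Jg] := ex f Kf; first by move=> T; apply/JJ'.
by exists g => T; apply/JJ'.
Qed.

Lemma exact_gt X J p : is_ideal J -> (#|X| < p)%N -> exact X J p.
Proof.
move=> idJ Xp f Kf _; apply: bnd_inJ => // T; rewrite Kf; first exact: ideal0.
by apply: contraL Xp => /andP[/subset_leq_card TX /eqP <-]; rewrite -leqNgt.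
Qed.

(** By [exact_add] each new element raises the top non-vanishing degree by at most one. *)
Lemma exact_addU X Y J b : is_ideal J -> [disjoint Y & X] ->
  (forall q, (b < q)%N -> exact X J q) ->
  forall q, (b + #|Y| < q)%N -> exact (Y :|: X) J q.
Proof.
move=> idJ; have [n] := ubnP #|Y|; elim: n Y b => // n IH Y b.
have [->|/set0Pn[a aY]] := eqVneq Y set0.
  by move=> _ _ ex q; rewrite set0U cards0 addn0; apply: ex.
rewrite (cardsD1 a) aY => Yn dYX ex [|q] //; rewrite addnCA ltnS => bq.
have dX : [disjoint Y :\ a & X] by apply: disjointWl dYX; apply: subD1set.
have aX : a \notin X by rewrite (disjointFr dYX).
rewrite -(setD1K aY) -setUA; apply: exact_add => //.
- by rewrite !inE eqxx.
- by apply: (IH _ b) => //; apply: leq_trans bq; rewrite addnC.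
- by apply: (IH _ b) => //; apply: leqW; apply: leq_trans bq; rewrite addnC.
Qed.

(* An element nilpotent modulo the others cannot act injectively on their homology, so
   adding it to the sequence raises the top non-vanishing degree. *)
Lemma exact_delU X Y J b : is_ideal J -> [disjoint Y & X] ->
  (forall a, a \in Y -> exists n, forall K : R -> Prop, is_ideal K ->
     (forall x, J x -> K x) -> (forall i, i \in X -> K (s i)) -> K (s a ^+ n)) ->
  (forall q, (b + #|Y| < q)%N -> exact (Y :|: X) J q) ->
  forall q, (b < q)%N -> exact X J q.
Proof.
move=> idJ; have [n] := ubnP #|Y|; elim: n Y b => // n IH Y b.
have [->|/set0Pn[a aY]] := eqVneq Y set0.
  by move=> _ _ _ ex q bq; rewrite -(set0U X); apply: ex; rewrite cards0 addn0.
rewrite (cardsD1 a) aY => Yn dYX nil ex.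
have dX : [disjoint Y :\ a & X] by apply: disjointWl dYX; apply: subD1set.
have aX : a \notin X by rewrite (disjointFr dYX).
apply: (IH (Y :\ a)) => // [c cY|q bq w Kw Jw]; first by apply: nil; case/setD1P: cY.
have [N nilN] := nil a aY.
have aYX : a \notin Y :\ a :|: X by rewrite !inE eqxx.
have exa : exact (a |: (Y :\ a :|: X)) J q.+1.
  by rewrite setUA setD1K //; apply: ex; rewrite addnCA.
have inj m : bnd (Y :\ a :|: X) J (s a ^+ m *k w) -> bnd (Y :\ a :|: X) J w.
  elim: m => [|m IHm]; first by rewrite expr0 kscale1.
  rewrite exprS -kscaleK => bw; apply: IHm.
  by apply: (exact_inj idJ aYX exa (kin_scale _ Kw)) bw; apply: inJ_kdiff_scale.
(* The annihilator of the class of [w] contains [J] and the [s i], hence a power of [s a]. *)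
apply: (inj N); apply: (nilN (fun x => bnd (Y :\ a :|: X) J (x *k w))).
- exact: bnd_ideal.
- by move=> x Jx; apply: bnd_scale_J.
- by move=> i iX; apply: bnd_scale_gen => //; rewrite inE iX orbT.
Qed.

(* A regular element [a] acts injectively on homology if the next homology modulo [a]
   vanishes; but it also acts nilpotently, since the [x v ^+ 2] kill homology. *)
Lemma exact_regular_nil (A : finType) (x : A -> R) (a : R) X J p : is_ideal J ->
  (forall v (K : R -> Prop), is_ideal K -> (forall y, J y -> K y) ->
     (forall i, i \in X -> K (s i)) -> K (x v * x v)) ->
  (forall K : R -> Prop, is_ideal K -> (forall y, J y -> K y) ->
     (forall v, K (x v)) -> K a) ->
  (forall y, J (a * y) -> J y) ->
  exact X (adjoin J a) p.+1 -> exact X J p.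
Proof.
move=> idJ sqr gen reg ex.
(* Induction on the list [L] of variables not yet known to kill the class of [f]. Passing to
   [x v *k f] takes [v] off the list, because [x v * x v] kills the class; once [L] is empty, [a]
   itself kills it. *)
suff step (L : seq A) f : kin X p f -> inJ J (kdiff X f) ->
    (forall v, v \notin L -> bnd X J (x v *k f)) -> bnd X J f.
  move=> f Kf Jf; apply: (step (enum A)) => // v; by rewrite mem_enum.
elim: L f => [|v L IH] f Kf Jf kill.
  apply: (exact_regular idJ reg ex) => //.
  apply: (gen (fun y => bnd X J (y *k f))); first exact: bnd_ideal.
    by move=> y Jy; apply: bnd_scale_J.
  by move=> v; apply: kill.
have idK := bnd_ideal X f idJ.
have kv : bnd X J (x v *k f).
  apply: IH => [||u uL]; [exact: kin_scale|exact: inJ_kdiff_scale|].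
  rewrite kscaleK; have [->|uv] := eqVneq u v.
    apply: (sqr v (fun y => bnd X J (y *k f))) => // [y Jy|i iX].
      exact: bnd_scale_J.
    exact: bnd_scale_gen.
  by rewrite mulrC; apply: (idealM idK); apply: kill; rewrite inE negb_or uv.
apply: IH => // u uL; have [->//|uv] := eqVneq u v.
by apply: kill; rewrite inE negb_or uv.
Qed.

Lemma kdiff_set0_in X (K : R -> Prop) f : is_ideal K -> (forall i, i \in X -> K (s i)) ->
  K (kdiff X f set0).
Proof.
move=> idK Ks; rewrite kdiffE; apply: ideal_sum => // i iX.
by rewrite mulrC; apply: idealM => //; apply: Ks.
Qed.

Definition kpoint (y : R) : kchain := [ffun T : {set I} => if T == set0 then y else 0].

Lemma kin_kpoint X y : kin X 0 (kpoint y).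
Proof.
move=> T nT; rewrite ffunE; case: eqP => // T0.
by rewrite T0 sub0set cards0 eqxx in nT.
Qed.

Lemma kscale_kpoint b y : b *k kpoint y = kpoint (b * y).
Proof. by apply/ffunP=> T; rewrite !ffunE; case: ifP; rewrite ?mulr0. Qed.

(** H_0 is the ring modulo [J] and the [s i]; the ideal they generate is expressed as the
    intersection of all ideals containing them. *)
Lemma bnd_kpointP X J y : is_ideal J ->
  bnd X J (kpoint y) <->
  (forall K : R -> Prop, is_ideal K -> (forall x, J x -> K x) ->
     (forall i, i \in X -> K (s i)) -> K y).
Proof.
move=> idJ; split=> [[g Jg] K idK JK Ks|]; last first.
  move/(_ (fun x => bnd X J (kpoint x))); apply=> [|x Jx|i iX].
  - have E x : kpoint x = x *k kpoint 1 by rewrite kscale_kpoint mulr1.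
    have [b0 bM] := bnd_ideal X (kpoint 1) idJ.
    split=> [|b x x']; first by rewrite (E 0).
    by rewrite (E x) (E x') (E (b * x + x')); apply: bM.
  - by apply: bnd_inJ => // T; rewrite ffunE; case: ifP => // _; apply: ideal0.
  - rewrite -[s i]mulr1 -kscale_kpoint; apply: bnd_scale_gen => //.
    by rewrite (kdiff_kin0 (@kin_kpoint X 1)); apply: inJ0.
have := JK _ (Jg set0); rewrite !ffunE eqxx => Ky.
by rewrite -[y](subrK (kdiff X g set0)); apply: idealD => //; apply: kdiff_set0_in.
Qed.

(** The degree 0 case of [exact_inj]: vanishing of H_1 makes [s a] a non-zero-divisor modulo [J] and
    the remaining elements. *)
Lemma exact1_regular a X J y : is_ideal J -> a \notin X -> exact (a |: X) J 1 ->
  (forall K : R -> Prop, is_ideal K -> (forall x, J x -> K x) ->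
     (forall i, i \in X -> K (s i)) -> K (s a * y)) ->
  (forall K : R -> Prop, is_ideal K -> (forall x, J x -> K x) ->
     (forall i, i \in X -> K (s i)) -> K y).
Proof.
move=> idJ aX ex say; apply/(@bnd_kpointP X J y idJ).
apply: (exact_inj idJ aX ex (@kin_kpoint X y)).
  by rewrite (kdiff_kin0 (@kin_kpoint X y)); apply: inJ0.
by rewrite kscale_kpoint; apply/bnd_kpointP.
Qed.

End Koszul.

(** * Monomials indexed by vertices, and squarefree monomial ideals *)

Section Monomials.
Variables (k : fieldType) (V : finType).
Local Notation mono := 'X_{1..#|V|}.
Local Notation S := {mpoly k[#|V|]}.
Implicit Types (m : mono) (p q : S) (F G : {set V}) (u v : V) (fam : {set {set V}}).

Definition mvar v : mono := U_(enum_rank v)%MM.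

Definition mexp m v : nat := m (enum_rank v).

Definition mvert m : {set V} := [set v | mexp m v != 0%N].

Definition mface F : mono := [multinom (enum_val i \in F : nat) | i < #|V|].

Lemma mexpP m m' : mexp m =1 mexp m' -> m = m'.
Proof. by move=> e; apply/mnmP=> i; have := e (enum_val i); rewrite /mexp enum_valK. Qed.

Lemma mexp_var u v : mexp (mvar u) v = (u == v).
Proof. by rewrite /mexp mnm1E (inj_eq enum_rank_inj). Qed.

Lemma mexpD m m' v : mexp (m + m')%MM v = (mexp m v + mexp m' v)%N.
Proof. exact: mnmDE. Qed.

Lemma mexpB m m' v : mexp (m - m')%MM v = (mexp m v - mexp m' v)%N.
Proof. exact: mnmBE. Qed.

Lemma mexp0 v : mexp 0%MM v = 0%N.
Proof. exact: mnm0E. Qed.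

Lemma mexp_face F v : mexp (mface F) v = (v \in F).
Proof. by rewrite /mexp mnmE enum_rankK. Qed.

Lemma mexp_le m m' : (m <= m')%MM = [forall v, (mexp m v <= mexp m' v)%N].
Proof.
apply/mnm_lepP/forallP => [le v|le i]; first exact: le.
by have := le (enum_val i); rewrite /mexp enum_valK.
Qed.

Lemma mvertD m m' : mvert (m + m') = mvert m :|: mvert m'.
Proof. by apply/setP=> v; rewrite !inE mexpD addn_eq0 negb_and. Qed.

Lemma mvert_var v : mvert (mvar v) = [set v].
Proof. by apply/setP=> u; rewrite !inE mexp_var eqb0 negbK eq_sym. Qed.

Lemma mvert_face F : mvert (mface F) = F.
Proof. by apply/setP=> u; rewrite !inE mexp_face eqb0 negbK. Qed.

Lemma mvert0 : mvert 0 = set0.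
Proof. by apply/setP=> u; rewrite !inE mexp0. Qed.

Lemma mvertB m m' : mvert (m - m') \subset mvert m.
Proof.
apply/subsetP=> u; rewrite !inE mexpB; apply: contraNneq => ->.
by rewrite sub0n.
Qed.

Lemma mface_le F m : (mface F <= m)%MM = (F \subset mvert m).
Proof.
rewrite mexp_le; apply/forallP/subsetP => [le v vF|sub v].
  by have := le v; rewrite mexp_face vF inE lt0n.
by rewrite mexp_face; case: (boolP (v \in F)) => // /sub; rewrite inE lt0n.
Qed.

Lemma mvar_le v m : (mvar v <= m)%MM = (v \in mvert m).
Proof. by rewrite /mvar lep1mP inE. Qed.

Lemma SR_varE v : SR_var k v = 'X_[mvar v]. Proof. by []. Qed.

Lemma prod_SR_var F : \prod_(v in F) SR_var k v = 'X_[mface F].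
Proof.
rewrite mpolyXE_id (reindex enum_rank) /=; last first.
  by apply: onW_bij; apply: enum_rank_bij.
rewrite [RHS](bigID (mem F)) /= [X in _ * X]big1 ?mulr1 => [|v /negPf vF].
  by apply: eq_bigr => v vF; rewrite -/(mexp _ v) mexp_face vF expr1.
by rewrite -/(mexp _ v) mexp_face vF expr0.
Qed.

Lemma mcoeffXM m1 p m :
  ('X_[m1] * p)@_m = if (m1 <= m)%MM then p@_(m - m1) else 0.
Proof.
rewrite mulrC; case: ifP => le; first by rewrite -{1}(submK le) addmC mcoeffMX.
apply: memN_msupp_eq0; apply/negP; rewrite (perm_mem (msuppMX _ _)).
by case/mapP=> m2 _ E; rewrite E lem_addr in le.
Qed.

Lemma mcoeff_varM v p m :
  (SR_var k v * p)@_m = if v \in mvert m then p@_(m - mvar v) else 0.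
Proof. by rewrite SR_varE mcoeffXM mvar_le. Qed.

(* The polynomial with coefficients [a], provided that they vanish off [r]. *)
Definition mpoly_of (a : mono -> k) (r : seq mono) : S :=
  \sum_(m <- undup r) a m *: 'X_[m].

Lemma mcoeff_mpoly_of a r m : (forall m', a m' != 0 -> m' \in r) ->
  (mpoly_of a r)@_m = a m.
Proof.
move=> ar; rewrite /mpoly_of linear_sum /=.
under eq_bigr do rewrite mcoeffZ mcoeffX.
have [mr|mr] := boolP (m \in undup r).
  rewrite (bigD1_seq m) ?undup_uniq //= eqxx mulr1 big1 ?addr0 // => m' /negPf ->.
  by rewrite mulr0.
rewrite big_seq big1 => [|m' m'r].
  apply/eqP; rewrite eq_sym; apply/negP => /negP /ar mr'.
  by rewrite mem_undup mr' in mr.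
case: eqP => [E|_]; last by rewrite mulr0.
by rewrite -E m'r in mr.
Qed.

Definition mfilter (Q : pred mono) p : S :=
  mpoly_of (fun m => if Q m then p@_m else 0) (msupp p).

Lemma mcoeff_filter Q p m : (mfilter Q p)@_m = if Q m then p@_m else 0.
Proof.
rewrite mcoeff_mpoly_of // => m'; case: ifP => _; rewrite ?eqxx //.
by rewrite mcoeff_msupp.
Qed.

(** The Stanley-Reisner ideal, read off coefficients. It takes a family of sets because simplices on
    some of the vertices, and complexes with a facet removed, need not contain every vertex as a
    [complex V] does. *)
Definition monomial_ideal fam : S -> Prop :=
  fun p => forall m, mvert m \in fam -> p@_m = 0.

Definition down_closed fam := forall F G, F \in fam -> G \subset F -> G \in fam.

Lemma down_closed_powerset F : down_closed (powerset F).
Proof. by move=> G G'; rewrite !powersetE => GF /subset_trans; apply. Qed.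

Lemma down_closed_facet fam F : down_closed fam ->
  (forall G, G \in fam -> F \subset G -> G = F) -> down_closed (fam :\ F).
Proof.
move=> dc Fmax G G' /setD1P[GF Gf] G'G; rewrite !inE (dc _ _ Gf G'G) andbT.
by apply: contraNneq GF => E; rewrite E in G'G; apply/eqP/Fmax.
Qed.

Lemma monomial_ideal_ideal fam : down_closed fam -> is_ideal (monomial_ideal fam).
Proof.
move=> dc; split=> [m _|a x y Jx Jy m mF]; first by rewrite mcoeff0.
rewrite mcoeffD Jy // addr0 [a]mpolyE mulr_suml linear_sum /= big1 // => m1 _.
rewrite -scalerAl mcoeffZ mcoeffXM; case: ifP => _; rewrite ?mulr0 //.
by rewrite Jx ?mulr0 //; apply: dc mF (mvertB _ _).
Qed.

Lemma monomial_ideal_X fam m : mvert m \notin fam -> monomial_ideal fam 'X_[m].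
Proof. by move=> mF m' m'F; rewrite mcoeffX; case: eqP => // E; rewrite E m'F in mF. Qed.

(** Each monomial of [p] is a multiple of the squarefree monomial of its support, which is not in
    [fam]. *)
Lemma monomial_ideal_gen fam (J : S -> Prop) p : is_ideal J ->
  (forall F, F \notin fam -> J (\prod_(v in F) SR_var k v)) ->
  monomial_ideal fam p -> J p.
Proof.
move=> idJ gen Ip; rewrite [p]mpolyE big_seq; apply: ideal_sum => // m.
rewrite mcoeff_msupp => pm; rewrite -mul_mpolyC; apply: idealM => //.
have mF : mvert m \notin fam by apply: contra pm => /Ip ->.
have le : (mface (mvert m) <= m)%MM by rewrite mface_le.
by rewrite -(submK le) mpolyXD; apply: idealM => //; rewrite -prod_SR_var; apply: gen.
Qed.

Lemma ideal_gen_ideal (R : comNzRingType) (r : seq R) : is_ideal (ideal_gen r).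
Proof.
split=> [|a x y [cx ->] [cy ->]].
  by exists (fun=> 0); rewrite big1 // => i _; rewrite mul0r.
exists (fun i => a * cx i + cy i); rewrite mulr_sumr -big_split /=.
by apply: eq_bigr => i _; rewrite mulrDl mulrA.
Qed.

Lemma ideal_gen_mem (R : comNzRingType) (r : seq R) x : x \in r -> ideal_gen r x.
Proof.
move=> xr; have ir : (index x r < size r)%N by rewrite index_mem.
exists (fun i => (i == Ordinal ir)%:R).
rewrite (bigD1 (Ordinal ir)) //= eqxx mul1r nth_index // big1 ?addr0 // => i /negPf ->.
by rewrite mul0r.
Qed.

Lemma ideal_gen_sub (R : comNzRingType) (r : seq R) (J : R -> Prop) x :
  is_ideal J -> (forall y, y \in r -> J y) -> ideal_gen r x -> J x.
Proof.
move=> idJ Jr [c ->]; apply: ideal_sum => // i _; apply: idealM => //.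
by apply: Jr; apply: mem_nth.
Qed.

Lemma complex_down_closed (D : complex V) : down_closed (faces D).
Proof. by move=> F G FD GF; apply: complex_sub FD GF. Qed.

Lemma SR_idealP (D : complex V) p :
  p \in SR_ideal D <-> monomial_ideal (faces D) p.
Proof.
have idI := monomial_ideal_ideal (complex_down_closed (D := D)).
rewrite unfold_in; split=> [/boolp.asboolP|Ip].
  apply: ideal_gen_sub => // _ /imageP[F FD ->]; rewrite prod_SR_var.
  by apply: monomial_ideal_X; rewrite mvert_face; rewrite inE in FD.
apply/boolp.asboolP; apply: monomial_ideal_gen Ip; first exact: ideal_gen_ideal.
by move=> F FD; apply: ideal_gen_mem; apply/imageP; exists F => //; rewrite inE.
Qed.

End Monomials.

(** * Color sums [theta], and reduction of cycles at one vertex *)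

Section Coloring.
Variables (k : fieldType) (V : finType) (d : nat) (c : V -> 'I_d).
Local Notation mono := 'X_{1..#|V|}.
Local Notation S := {mpoly k[#|V|]}.
Implicit Types (m : mono) (p q : S) (F G : {set V}) (u v : V) (fam : {set {set V}}).

Definition rainbow fam := forall F, F \in fam -> {in F &, injective c}.

Lemma rainbow_powerset F : {in F &, injective c} -> rainbow (powerset F).
Proof. by move=> inj G; rewrite powersetE => /subsetP GF u v /GF uF /GF vF; apply: inj. Qed.

Definition theta (j : 'I_d) : S := \sum_(v | c v == j) SR_var k v.

Lemma mcoeff_thetaM j p m :
  (theta j * p)@_m = \sum_(v | (c v == j) && (v \in mvert m)) p@_(m - mvar v).
Proof.
rewrite mulr_suml linear_sum /= big_mkcondr; apply: eq_bigr => v _.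
exact: mcoeff_varM.
Qed.

Definition theta_esym (n : nat) : S := \sum_(T : {set 'I_d} | #|T| == n) \prod_(i in T) theta i.

(* The two sequences share one index type, so that they can be concatenated in either
   order inside the same Koszul complex. *)
Definition sop (i : 'I_d + 'I_d) : S :=
  match i with inl j => theta j | inr j => theta_esym j.+1 end.

Definition theta_ix : {set 'I_d + 'I_d} := [set inl j | j : 'I_d].

Definition esym_ix (t : nat) : {set 'I_d + 'I_d} := [set inr j | j : 'I_d & (j < t)%N].

Lemma inl_theta_ix j : inl j \in theta_ix.
Proof. exact: imset_f. Qed.

Lemma theta_ixP i : reflect (exists j, i = inl j) (i \in theta_ix).
Proof.
by apply: (iffP imsetP) => [[j _ ->]|[j ->]]; exists j.
Qed.

Lemma card_theta_ix : #|theta_ix| = d.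
Proof. by rewrite card_imset ?card_ord //; apply: inl_inj. Qed.

(** In [x_v * theta (c v)] every term other than [x_v ^ 2] is a product of two vertices of the same
    color, which is not a face. *)
Lemma sqr_vertex fam v (K : S -> Prop) : down_closed fam -> rainbow fam ->
  is_ideal K -> (forall y, monomial_ideal fam y -> K y) ->
  (forall i, i \in theta_ix -> K (sop i)) -> K (SR_var k v * SR_var k v).
Proof.
move=> dc rb idK IK Kth.
have -> : SR_var k v * SR_var k v = SR_var k v * theta (c v)
    - \sum_(u | (c u == c v) && (u != v)) SR_var k v * SR_var k u.
  by rewrite /theta (bigD1 v) //= mulrDr mulr_sumr addrK.
apply: idealB => //; first by apply: idealM => //; apply: (Kth _ (inl_theta_ix _)).
apply: ideal_sum => // u /andP[/eqP cuv uv]; apply: IK.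
rewrite !SR_varE -mpolyXD; apply: monomial_ideal_X.
apply: contra uv => uvF; apply/eqP; apply: (rb _ uvF) => //;
  by rewrite mvertD !mvert_var !inE eqxx ?orbT.
Qed.

(** Division by [x_v] of the part of [p] whose monomials have exponent of [x_v] greater than [b].
    For [b = 1] the support of a monomial is unchanged by the division, so every monomial ideal is
    preserved. *)
Definition vshift v (b : bool) p : S :=
  mpoly_of (fun m => if (b <= mexp m v)%N then p@_(m + mvar v) else 0)
           [seq (m - mvar v)%MM | m <- msupp p].

Lemma mcoeff_vshift v b p m :
  (vshift v b p)@_m = if (b <= mexp m v)%N then p@_(m + mvar v) else 0.
Proof.
rewrite mcoeff_mpoly_of // => m'; case: ifP; rewrite ?eqxx // => _ pm.
by apply/mapP; exists (m' + mvar v)%MM; rewrite ?mcoeff_msupp ?addmK.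
Qed.

Fact vshift_zmod v b : zmod_morphism (vshift v b).
Proof.
move=> p q; apply/mpolyP=> m; rewrite mcoeffB !mcoeff_vshift.
by case: ifP; rewrite ?mcoeffB ?subr0.
Qed.

HB.instance Definition _ v b :=
  GRing.isZmodMorphism.Build S S (vshift v b) (vshift_zmod v b).

Lemma mvar_subC m u v : u != v -> u \in mvert m -> (m - mvar u + mvar v = m + mvar v - mvar u)%MM.
Proof.
move=> uv um; apply: mexpP => w; rewrite !(mexpB, mexpD, mexp_var) addnBAC //.
by case: eqP => // <-; rewrite inE -lt0n in um.
Qed.

Lemma vshift_theta v b j p : j != c v -> vshift v b (theta j * p) = theta j * vshift v b p.
Proof.
move=> jv; apply/mpolyP=> m; rewrite mcoeff_vshift !mcoeff_thetaM.
under [RHS]eq_bigr do rewrite mcoeff_vshift.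
have uv u : c u == j -> u != v by move=> /eqP cu; apply: contraNneq jv => <-; apply/eqP.
case: ifP => bm; last first.
  rewrite big1 // => u /andP[cu um].
  by rewrite mexpB mexp_var (negPf (uv u cu)) subn0 bm.
apply: eq_big => [u|u /andP[cu um]].
  case: (boolP (c u == j)) => //= cu; rewrite mvertD mvert_var !inE.
  by rewrite (negPf (uv u cu)) orbF.
rewrite mexpB mexp_var (negPf (uv u cu)) subn0 bm mvar_subC ?uv //.
by move: um; rewrite mvertD mvert_var !inE (negPf (uv u cu)) orbF.
Qed.

(* Up to a Koszul boundary one may drop from a cycle the monomials that are
   divisible by [x_v ^+ 2] (for [b = 1], with the degree of [f T] shifted by the
   colors in [T]), or, if [v] is a cone point, by [x_v] (for [b = 0]): division by
   [x_v] is a contracting homotopy on the part that is dropped. *)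
Lemma reduce_vertex fam v (b : bool) (f : kchain S _) : down_closed fam -> rainbow fam ->
  (~~ b -> forall F, F \in fam -> v |: F \in fam) ->
  inJ (monomial_ideal fam) (kdiff sop theta_ix f) ->
  bnd sop theta_ix (monomial_ideal fam)
    (f - [ffun T : {set 'I_d + 'I_d} =>
            mfilter (fun m => mexp m v < b + (inl (c v) \notin T))%N (f T)]).
Proof.
move=> dc rb cone Jf; have idI : is_ideal (@monomial_ideal k V fam) by apply: monomial_ideal_ideal.
have coneP F : (b -> v \in F) -> F \in fam -> v |: F \in fam.
  case: b cone => [_ /(_ isT) vF FF|cone _]; last exact: cone.
  by rewrite (setUidPr _) ?sub1set.
have [||g Jg] := @exact_homotopy _ _ sop (inl (c v)) theta_ix _ (vshift v b) f idI
  (inl_theta_ix _) _ _ Jf.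
- move=> p Ip m mF; rewrite mcoeff_vshift; case: ifP => // bm; apply: Ip.
  rewrite mvertD mvert_var setUC coneP // => bT.
  by rewrite inE -lt0n; rewrite bT in bm.
- by move=> _ p /theta_ixP[j ->] jv; apply: vshift_theta; apply: contraNneq jv => ->.
exists g => T m mF; have := Jg T m mF; rewrite !ffunE !mcoeffB mcoeff_filter.
apply: etrans; congr (_ - _).
(* On a face containing [v], no other vertex has the color of [v], so [theta (c v)] acts as
   [x_v]. *)
have big_v (m' : mono) (h : V -> k) : v \in mvert m' -> mvert m' \in fam ->
    \sum_(u | (c u == c v) && (u \in mvert m')) h u = h v.
  move=> vm m'F; rewrite (bigD1 v) /= ?eqxx // big1 ?addr0 // => u /andP[/andP[/eqP cuv um]].
  by case/eqP; apply: rb m'F _ _ _ _ cuv.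
case: (boolP (inl (c v) \in T)) => iT; rewrite /= ?addn0.
  rewrite mcoeff_vshift ltnNge; case: (boolP (b <= mexp m v)%N) => bm; rewrite ?subr0 ?subrr //=.
  rewrite mcoeff_thetaM big_v ?addmK ?subr0 //.
    by rewrite mvertD mvert_var !inE eqxx orbT.
  rewrite mvertD mvert_var setUC coneP // => bT.
  by rewrite inE -lt0n; rewrite bT in bm.
rewrite mcoeff_thetaM addn1 ltnS.
under eq_bigr do rewrite mcoeff_vshift.
have [vm|vm] := boolP (v \in mvert m).
  rewrite big_v // mexpB mexp_var eqxx submK ?mvar_le //.
  have -> : (b <= mexp m v - true)%N = ~~ (mexp m v <= b)%N.
    by rewrite inE in vm; case: (mexp m v) vm => // e _; rewrite subn1 -ltnNge.
  by case: ifP => _; rewrite ?subr0 ?subrr.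
have v0 : mexp m v = 0%N by apply/eqP; rewrite inE negbK in vm.
rewrite v0 leq0n subrr big1 // => u /andP[/eqP cu um]; case: ifP => // bm.
(* A non-zero term would come from a vertex [u] of the color of [v] with [v |: mvert m] in [fam];
   this forces [u = v], which is not in the support of [m]. *)
have: v |: mvert m \in fam.
  by apply: coneP => // bT; rewrite bT mexpB v0 sub0n in bm.
move/rb=> inj; have uv : u = v by apply: inj => //; [apply: setU1r | apply: setU11].
by rewrite uv (negPf vm) in um.
Qed.

End Coloring.

(** * Successive reductions, simplices, and nilpotency of the color sums *)

Section Reduction.
Variables (k : fieldType) (V : finType) (d : nat) (c : V -> 'I_d).
Local Notation mono := 'X_{1..#|V|}.
Local Notation S := {mpoly k[#|V|]}.
Local Notation theta := (theta k c).
Local Notation sop := (sop k c).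
Local Notation theta_esym := (theta_esym k c).
Local Notation theta_ix := (theta_ix d).
Local Notation esym_ix := (esym_ix d).
Local Notation I_ fam := (@monomial_ideal k V fam).
Implicit Types (m : mono) (p q : S) (F G : {set V}) (u v : V) (fam : {set {set V}}).
Implicit Types (T : {set 'I_d + 'I_d}) (f g : kchain S ('I_d + 'I_d)%type).

Definition kfilter (Q : {set 'I_d + 'I_d} -> pred mono) f : kchain S _ :=
  [ffun T : {set 'I_d + 'I_d} => mfilter (Q T) (f T)].

Lemma kin_kfilter Q X (p : nat) f : kin X p f -> kin X p (kfilter Q f).
Proof.
move=> Kf T nT; rewrite ffunE Kf //; apply/mpolyP=> m.
by rewrite mcoeff_filter mcoeff0 if_same.
Qed.

Lemma bnd_cycle X fam f g : down_closed fam -> bnd sop X (I_ fam) (f - g) ->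
  inJ (I_ fam) (kdiff sop X f) -> inJ (I_ fam) (kdiff sop X g).
Proof.
move=> dc; have idI : is_ideal (I_ fam) by apply: monomial_ideal_ideal.
case=> h /(inJ_diff sop idI X); rewrite !(raddfB (kdiff sop X)) /= kdiffK subr0 => Jh Jf.
by have := inJB idI Jf Jh; rewrite opprB addrC subrK.
Qed.

(** The filters are applied one after the other; each result is homologous to the previous chain,
    hence again a cycle to which the next step applies. *)
Lemma kfilter_seq (E : eqType) (L : seq E) (Q : E -> {set 'I_d + 'I_d} -> pred mono) X fam
    (p : nat) f : down_closed fam ->
  (forall e g, e \in L -> kin X p g -> inJ (I_ fam) (kdiff sop X g) ->
     bnd sop X (I_ fam) (g - kfilter (Q e) g)) ->
  kin X p f -> inJ (I_ fam) (kdiff sop X f) ->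
  bnd sop X (I_ fam) (f - kfilter (fun T m => all (fun e => Q e T m) L) f).
Proof.
move=> dc; have idI : is_ideal (I_ fam) by apply: monomial_ideal_ideal.
elim: L => [|e L IH] step Kf Jf.
  by apply: bnd_inJ => // T m mF; rewrite !ffunE mcoeffB mcoeff_filter /= subrr.
pose g := kfilter (fun T m => all (fun e => Q e T m) L) f.
have bfg : bnd sop X (I_ fam) (f - g).
  by apply: IH => // e' h e'L; apply: step; rewrite inE e'L orbT.
have Kg : kin X p g by apply: kin_kfilter.
have Jg := bnd_cycle dc bfg Jf.
have := bndD idI bfg (step e g (mem_head _ _) Kg Jg); rewrite addrA subrK.
congr (bnd _ _ _ (_ - _)); apply/ffunP=> T; rewrite !ffunE.
by apply/mpolyP=> m; rewrite !mcoeff_filter /=; case: (Q e T m).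
Qed.

Lemma reduce_vertices fam (b : bool) (L : seq V) (p : nat) f : down_closed fam -> rainbow c fam ->
  (~~ b -> forall v F, v \in L -> F \in fam -> v |: F \in fam) ->
  kin theta_ix p f -> inJ (I_ fam) (kdiff sop theta_ix f) ->
  bnd sop theta_ix (I_ fam)
    (f - kfilter (fun T m => all (fun v => mexp m v < b + (inl (c v) \notin T))%N L) f).
Proof.
move=> dc rb cone; apply: kfilter_seq => // v g vL Kg Jg.
by apply: reduce_vertex => // bF F; apply: cone.
Qed.

(** Every vertex of a simplex is a cone point, so up to boundaries a cycle lives on sets [T]
    avoiding all colors of [F]. Such a [T] has at most [d - #|F|] elements. *)
Lemma simplex_exact F (p : nat) : {in F &, injective c} -> (d < p + #|F|)%N ->
  exact sop theta_ix (I_ (powerset F)) p.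
Proof.
move=> injF dp f Kf Jf.
have dc := @down_closed_powerset _ F; have rb := rainbow_powerset injF.
have [|g Jg] := @reduce_vertices _ false (enum F) p f dc rb _ Kf Jf.
  move=> _ v G; rewrite mem_enum !powersetE => vF GF.
  by rewrite subUset sub1set vF.
exists g; move: Jg; set h := kfilter _ f; suff -> : h = 0 by rewrite subr0.
apply/ffunP=> T; rewrite !ffunE; apply/mpolyP=> m; rewrite mcoeff_filter mcoeff0.
have [/andP[Tth /eqP Tp]|nT] := boolP ((T \subset theta_ix) && (#|T| == p)); last first.
  by rewrite Kf // mcoeff0 if_same.
suff [v vF vT] : exists2 v, v \in F & inl (c v) \in T.
  by case: allP => // /(_ v); rewrite mem_enum vF vT ltn0 => /(_ isT).
apply/exists_inP; apply: contraLR dp => /exists_inPn nT.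
pose C : {set 'I_d + 'I_d} := [set inl (c v) | v in F].
have CF : #|C| = #|F| by rewrite card_in_imset // => u v uF vF [] /injF; apply.
have dTC : [disjoint T & C].
  rewrite -setI_eq0; apply/eqP/setP=> i; rewrite !inE; apply/negP=> /andP[iT /imsetP[v vF E]].
  by have := nT v vF; rewrite -E iT.
rewrite -leqNgt -Tp -CF -cardsUI; move: dTC; rewrite -setI_eq0 => /eqP ->.
rewrite cards0 addn0 -[leqRHS](card_theta_ix d); apply: subset_leq_card.
rewrite subUset Tth; apply/subsetP=> _ /imsetP[v _ ->]; exact: inl_theta_ix.
Qed.

Lemma mem_esym_ix t i : (i \in esym_ix t) = if i is inr j then (j < t)%N else false.
Proof.
apply/imsetP/idP => [[j jt ->]|]; first by rewrite inE in jt.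
by case: i => // j jt; exists j; rewrite ?inE.
Qed.

Lemma card_esym_ix t : (t <= d)%N -> #|esym_ix t| = t.
Proof.
move=> td; rewrite card_imset; last exact: inr_inj.
rewrite -sum1_card (eq_bigl (fun j : 'I_d => (j < t)%N)); last by move=> j; rewrite inE.
by rewrite (big_ord_narrow td) /= sum1_card card_ord.
Qed.

Lemma esym_ixS t (td : (t < d)%N) : esym_ix t.+1 = inr (Ordinal td) |: esym_ix t.
Proof.
apply/setP=> i; rewrite !inE !mem_esym_ix; case: i => j //=.
by rewrite ltnS leq_eqVlt.
Qed.

Lemma theta_esym_disjoint t : [disjoint theta_ix & esym_ix t].
Proof.
rewrite -setI_eq0; apply/eqP/setP=> i; rewrite !inE mem_esym_ix.
by case: i => j; rewrite ?andbF //; apply/negP=> /andP[/theta_ixP[]].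
Qed.

Lemma mcoeff_prod_theta (A : {set 'I_d}) p m :
  ((\prod_(i in A) theta i) * p)@_m != 0 -> A \subset c @: mvert m.
Proof.
move=> nz; apply/subsetP=> i iA; move: nz; rewrite (bigD1 i) //= -mulrA mcoeff_thetaM.
have [//|nim] := boolP (i \in c @: mvert m).
rewrite [X in X != 0]big_pred0 ?eqxx // => v; apply/negbTE/negP => /andP[/eqP cv vm].
by case/negP: nim; rewrite -cv imset_f.
Qed.

Lemma theta_esym_in_ideal fam n p :
  (forall F, F \in fam -> (#|F| < n)%N) -> I_ fam (theta_esym n * p).
Proof.
move=> sz m mF; rewrite mulr_suml linear_sum big1 //= => A /eqP An.
apply/eqP; apply: contraTT (sz _ mF) => /mcoeff_prod_theta /subset_leq_card.
by rewrite An -leqNgt => /leq_trans; apply; apply: leq_imset_card.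
Qed.

(** [theta j] is a root of the monic polynomial with roots [theta i], whose lower coefficients are
    the [theta_esym n] up to sign. These lie in [K] by hypothesis if [n <= t]; if [n > t], all their
    monomials involve more than [t] colors. *)
Lemma theta_nilpotent fam t j (K : S -> Prop) : (forall F, F \in fam -> (#|F| <= t)%N) ->
  is_ideal K -> (forall x, I_ fam x -> K x) -> (forall i, i \in esym_ix t -> K (sop i)) ->
  K (theta j ^+ d).
Proof.
move=> sz idK IK Ke.
have cA (A : {set 'I_d}) : (#|A| < d.+1)%N by rewrite ltnS -[leqRHS](card_ord d) max_card.
have : \prod_i (- theta i + theta j) = 0 by rewrite (bigD1 j) //= addNr mul0r.
(* The expansion is grouped by the number [n] of factors [- theta i] chosen; [n = 0] gives
   [theta j ^+ d]. *)
rewrite bigA_distr (partition_big (fun A : {set 'I_d} => inord #|A| : 'I_d.+1) predT) //=.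
rewrite (bigD1 ord0) //= (big_pred1 set0) => [|A]; last first.
  by rewrite -val_eqE /= inordK ?cards_eq0.
under eq_bigr do rewrite inE; rewrite prodr_const card_ord => /eqP.
rewrite addr_eq0 => /eqP ->; apply: idealN => //.
apply: ideal_sum => // n n0.
have -> : \sum_(A : {set 'I_d} | inord #|A| == n) \prod_i (if i \in A then - theta i else theta j)
   = theta_esym n * ((-1) ^+ n * theta j ^+ (d - n)).
  rewrite /theta_esym mulr_suml; apply: eq_big => [A|A].
    by rewrite -val_eqE /= inordK.
  rewrite -val_eqE /= inordK //.
  move=> /eqP <-; rewrite (bigID (mem A)) /=; rewrite mulrA; congr (_ * _).
    rewrite (eq_bigr (fun i => - theta i)) => [|i ->] //.
    by rewrite prodrN mulrC.
  rewrite (eq_bigr (fun=> theta j)) => [|i /negPf ->] //.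
  rewrite prodr_const; congr (_ ^+ _).
  by apply/eqP; rewrite -(eqn_add2l #|A|) cardC card_ord subnKC // -ltnS.
have [nt|tn] := leqP n t; last first.
  by apply: IK; apply: theta_esym_in_ideal => F /sz Ft; apply: leq_ltn_trans Ft tn.
(* The index [inr j] stands for [theta_esym j.+1], whence the predecessor. *)
have n1 : (n.-1 < d)%N by rewrite -ltnS prednK ?lt0n // ltn_ord.
rewrite mulrC; apply: idealM => //.
have := Ke (inr (Ordinal n1)); rewrite mem_esym_ix /= prednK ?lt0n //; apply.
by rewrite nt.
Qed.

End Reduction.

(** * Regularity of the elementary symmetric polynomials in the color sums *)

Section ElementarySymmetric.
Variables (k : fieldType) (V : finType) (d : nat) (c : V -> 'I_d).
Local Notation mono := 'X_{1..#|V|}.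
Local Notation S := {mpoly k[#|V|]}.
Local Notation theta := (theta k c).
Local Notation sop := (sop k c).
Local Notation theta_ix := (theta_ix d).
Local Notation esym_ix := (esym_ix d).
Local Notation I_ fam := (@monomial_ideal k V fam).
Implicit Types (m : mono) (F G : {set V}) (u v : V) (fam : {set {set V}}).
Implicit Types (T : {set 'I_d + 'I_d}) (f g : kchain S ('I_d + 'I_d)%type).

(** Both sequences are compared with their concatenation: adding the [t] elementary symmetric
    polynomials raises the bound [d - t] on the top degree to [d], and deleting the [d] nilpotent
    color sums lowers it to 0. *)
Lemma exact_esym_skeleton fam t : down_closed fam -> rainbow c fam -> (t <= d)%N ->
  (forall F, F \in fam -> (#|F| <= t)%N) ->
  (forall p : nat, (d - t < p)%N -> exact sop theta_ix (I_ fam) p) ->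
  forall q, (0 < q)%N -> exact sop (esym_ix t) (I_ fam) q.
Proof.
move=> dc rb td sz ex; have idI : is_ideal (I_ fam) by apply: monomial_ideal_ideal.
apply: (@exact_delU _ _ _ _ theta_ix) => //; first exact: theta_esym_disjoint.
  move=> _ /theta_ixP[j ->]; exists d => K idK IK Ke.
  exact: (theta_nilpotent j sz idK IK Ke).
rewrite add0n setUC => q dq; apply: (@exact_addU _ _ _ _ _ _ (d - t)) ex _ _ => //.
  by rewrite disjoint_sym theta_esym_disjoint.
by rewrite card_esym_ix // subnK // -{1}(card_theta_ix d).
Qed.

Definition sop_deg (i : 'I_d + 'I_d) : nat := match i with inl _ => 1 | inr j => j.+1 end.

Lemma sop_homog i : sop i \is (sop_deg i).-homog.
Proof.
have thetaH j : theta j \is 1.-homog.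
  by apply: rpred_sum => v _; rewrite SR_varE dhomogX /= mdeg1.
case: i => j /=; first exact: thetaH.
apply: rpred_sum => A /eqP <-.
suff: \prod_(i in A) theta i \is (\sum_(i in A) 1)%N.-homog by rewrite sum1_card.
apply: (big_rec2 (fun (p : S) n => p \is n.-homog)) => [|i n p _ Hp]; first exact: dhomog1.
exact: dhomogM.
Qed.

Fact mfilter_zmod (Q : pred mono) : zmod_morphism (mfilter (k := k) Q).
Proof.
move=> p q; apply/mpolyP=> m; rewrite mcoeffB !mcoeff_filter.
by case: ifP; rewrite ?mcoeffB ?subr0.
Qed.

HB.instance Definition _ (Q : pred mono) :=
  GRing.isZmodMorphism.Build S S (mfilter (k := k) Q) (mfilter_zmod Q).

Lemma mfilter_homogM (a p : S) (w e D : nat) : a \is w.-homog ->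
  mfilter (fun m => mdeg m + e < D)%N (a * p) =
  a * mfilter (fun m => mdeg m + (w + e) < D)%N p.
Proof.
move=> aH; rewrite [a]mpolyE !mulr_suml raddf_sum /= big_seq [RHS]big_seq.
apply: eq_bigr => m1 /(dhomog_mf aH) /= m1w; apply/mpolyP=> m.
rewrite mcoeff_filter -!scalerAl !mcoeffZ !mcoeffXM mcoeff_filter.
case: (boolP (m1 <= m)%MM) => [le|_]; last by rewrite mulr0 if_same.
have -> : (mdeg (m - m1)%MM + (w + e) = mdeg m + e)%N.
  by rewrite addnA -m1w -mdegD submK.
by case: ifP; rewrite ?mulr0.
Qed.

(** The basis vector of [T] is given the total degree of the [sop i], [i] in [T]; then [kdiff]
    preserves degree and commutes with truncation. *)
Definition ktrunc (D : nat) f : kchain S _ :=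
  kfilter (fun T m => mdeg m + \sum_(i in T) sop_deg i < D)%N f.

Lemma ktrunc_scale D i f : ktrunc D (kscale (sop i) f) =
  kscale (sop i) (ktrunc (D - sop_deg i) f).
Proof.
apply/ffunP=> T; rewrite !ffunE (mfilter_homogM _ _ _ (sop_homog i)); congr (_ * _).
apply/mpolyP=> m; rewrite !mcoeff_filter ltn_subRL.
by rewrite [X in (X < _)%N]addnCA.
Qed.

Lemma ktruncB D f g : ktrunc D (f - g) = ktrunc D f - ktrunc D g.
Proof. by apply/ffunP=> T; rewrite !ffunE raddfB. Qed.

Lemma ktrunc_diff D X f : ktrunc D (kdiff sop X f) = kdiff sop X (ktrunc D f).
Proof.
apply/ffunP=> T; rewrite ffunE !kdiffE raddf_sum; apply: eq_bigr => i iX.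
rewrite /= (mfilter_homogM _ _ _ (sop_homog i)); congr (_ * _); rewrite !ffunE.
case: ifP => iT; first by rewrite raddf0.
have -> : (sop_deg i + \sum_(j in T) sop_deg j = \sum_(j in i |: T) sop_deg j)%N.
  by rewrite big_setU1 ?iT.
rewrite /koszul_sign; exact: (raddfMsign (mfilter _)).
Qed.

Lemma inJ_trunc fam D f : inJ (I_ fam) f -> inJ (I_ fam) (ktrunc D f).
Proof. by move=> Jf T m mF; rewrite ffunE mcoeff_filter Jf // if_same. Qed.

Lemma ktrunc_large f : exists D, ktrunc D f = f.
Proof.
exists (\max_T (msize (f T) + \sum_(i in T) sop_deg i)).+1.
apply/ffunP=> T; rewrite ffunE; apply/mpolyP=> m; rewrite mcoeff_filter.
case: ifPn => // big; apply/eqP; rewrite eq_sym mcoeff_eq0; apply/negP=> mf.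
case/negP: big; rewrite ltnS; apply: leq_trans (leq_bigmax T).
by rewrite leq_add2r ltnW // msize_mdeg_lt.
Qed.

(* Nakayama: [H_q] of the shorter sequence equals [e_(t+1) * H_q], hence vanishes since it
   is bounded below in degree. *)
Lemma exact_esym_shorten fam t : down_closed fam -> (t < d)%N ->
  (forall q, (0 < q)%N -> exact sop (esym_ix t.+1) (I_ fam) q) ->
  forall q, (0 < q)%N -> exact sop (esym_ix t) (I_ fam) q.
Proof.
move=> dc td ex q q0; have idI : is_ideal (I_ fam) by apply: monomial_ideal_ideal.
pose a : 'I_d + 'I_d := inr (Ordinal td).
have aE : a \notin esym_ix t by rewrite mem_esym_ix /= ltnn.
have E : esym_ix t.+1 = a |: esym_ix t := esym_ixS td.
suff key D f : kin (esym_ix t) q f -> inJ (I_ fam) (kdiff sop (esym_ix t) f) ->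
    bnd sop (esym_ix t) (I_ fam) (ktrunc D f).
  by move=> f Kf Jf; have [D <-] := ktrunc_large f; apply: key.
elim/ltn_ind: D f => D IH f Kf Jf.
have [|u [v [Kv Jv Juv]]] := exact_decomp idI aE _ Kf Jf; first by rewrite -E; apply: ex.
case: D IH => [|D] IH.
  apply: bnd_inJ => // T; suff -> : ktrunc 0 f T = 0 by apply: ideal0.
  by rewrite ffunE; apply/mpolyP=> m; rewrite mcoeff_filter mcoeff0.
(* Below degree [D.+1], [f] is up to boundaries [sop a] times the part of [v] below degree
   [D.+1 - sop_deg a]. As [sop_deg a] is positive, the induction hypothesis covers that part. *)
have [|h Jh] := IH (D.+1 - sop_deg a)%N _ v Kv Jv; first by rewrite /= subSS ltnS leq_subr.
exists (ktrunc D.+1 u + kscale (sop a) h).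
have := inJ_trunc D.+1 Juv; rewrite !ktruncB ktrunc_diff ktrunc_scale => J1.
have := inJD idI J1 (inJZ idI (sop a) Jh).
rewrite raddfB /= -kdiff_scale addrA subrK => J2.
by rewrite raddfD /= opprD addrA.
Qed.

Lemma exact_esym_leq fam t t' : down_closed fam -> (t' <= t <= d)%N ->
  (forall q, (0 < q)%N -> exact sop (esym_ix t) (I_ fam) q) ->
  forall q, (0 < q)%N -> exact sop (esym_ix t') (I_ fam) q.
Proof.
move=> dc /andP[]; elim: t => [|t IH] t't td ex; first by move: t't; rewrite leqn0 => /eqP ->.
move: t't; rewrite leq_eqVlt => /orP[/eqP -> //|]; rewrite ltnS => t't.
by apply: IH => //; [apply: ltnW | apply: exact_esym_shorten].
Qed.

(** For a facet [F], the union of [F] and the support of [m] is a face exactly when the support lies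
    in [F]. *)
Lemma colon_facet fam F p : down_closed fam -> F \in fam ->
  (forall G, G \in fam -> F \subset G -> G = F) ->
  I_ (powerset F) p <-> colon (I_ fam) 'X_[mface F] p.
Proof.
move=> dc FF Fmax; split=> [Ip m mF|Ip m].
  rewrite mcoeffXM mface_le; case: ifP => // Fm; apply: Ip.
  by rewrite powersetE -(Fmax _ mF Fm) mvertB.
rewrite powersetE => mF; have := Ip (m + mface F)%MM.
by rewrite mcoeffXM lem_addl addmK; apply; rewrite mvertD mvert_face (setUidPr mF).
Qed.

Lemma adjoin_facet fam F p : down_closed fam -> F \in fam ->
  (forall G, G \in fam -> F \subset G -> G = F) ->
  I_ (fam :\ F) p <-> adjoin (I_ fam) 'X_[mface F] p.
Proof.
move=> dc FF Fmax; have idI : is_ideal (I_ fam) by apply: monomial_ideal_ideal.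
split.
  apply: monomial_ideal_gen; first exact: adjoin_ideal.
  move=> G; rewrite !inE negb_and negbK => /orP[/eqP ->|GF].
    by rewrite prod_SR_var -[X in adjoin _ _ X]mulr1; apply: adjoin_gen.
  apply: adjoin_sub; rewrite prod_SR_var.
  by apply: monomial_ideal_X; rewrite mvert_face.
case=> y Iy m; rewrite !inE => /andP[mF mf].
have := Iy m mf; rewrite mcoeffB mcoeffXM mface_le; case: ifP => [Fm|_].
  by rewrite (Fmax _ mf Fm) eqxx in mF.
by rewrite subr0.
Qed.

Lemma exact_esym fam t : down_closed fam -> rainbow c fam -> (t <= d)%N ->
  (forall p : nat, (d - t < p)%N -> exact sop theta_ix (I_ fam) p) ->
  forall q, (0 < q)%N -> exact sop (esym_ix t) (I_ fam) q.
Proof.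
have [n] := ubnP #|[set F in fam | t < #|F|]|%N; elim: n fam => // n IH fam famn dc rb td ex.
have idI : is_ideal (I_ fam) by apply: monomial_ideal_ideal.
have [E0|] := eqVneq [set F in fam | t < #|F|]%N set0.
  apply: exact_esym_skeleton => // F FF; rewrite leqNgt; apply/negP=> tF.
  by move: (in_set0 F); rewrite -E0 inE FF tF.
case/set0Pn=> F0 F0P.
have [F] := @arg_maxnP _ F0 (mem [set F in fam | t < #|F|]%N) (fun F => #|F|) F0P.
rewrite /= inE => /andP[FF tF] Fm.
have Fmax G : G \in fam -> F \subset G -> G = F.
  move=> GF FG; apply/eqP; rewrite eq_sym eqEcard FG; apply: Fm.
  by rewrite inE GF (leq_trans tF) // subset_leq_card.
have dc' := down_closed_facet dc Fmax.
have rb' : rainbow c (fam :\ F) by move=> G /setD1P[_]; apply: rb.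
have dcF := @down_closed_powerset _ F; have rbF := rainbow_powerset (rb _ FF).
have Fd : (#|F| <= d)%N.
  by rewrite -[leqRHS]card_ord -(card_in_imset (rb _ FF)) max_card.
have colE p : I_ (powerset F) p <-> colon (I_ fam) 'X_[mface F] p by apply: colon_facet.
have adjE p : I_ (fam :\ F) p <-> adjoin (I_ fam) 'X_[mface F] p by apply: adjoin_facet.
have simplex (p : nat) : (d - #|F| < p)%N -> exact sop theta_ix (I_ (powerset F)) p.
  by move=> dFp; apply: (simplex_exact (rb _ FF)); rewrite addnC -ltn_subLR.
move=> q q0; apply: (@exact_colon_adjoin _ _ _ 'X_[mface F]) => //.
  (* The faces of the simplex on [F] have at most [#|F|] vertices, so the skeleton case applies with
     [#|F|] in place of [t]; the sequence is then shortened to length [t]. *)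
  apply: (exact_iff colE); apply: (@exact_esym_leq _ #|F|) => //.
    by rewrite (ltnW tF) Fd.
  apply: exact_esym_skeleton => // G; rewrite powersetE; exact: subset_leq_card.
apply: (exact_iff adjE); apply: IH => //.
  rewrite ltnS in famn; apply: leq_trans famn; apply: proper_card.
  apply/properP; split; first by apply/subsetP=> G; rewrite !inE -andbA => /and3P[_ -> ->].
  by exists F; rewrite !inE ?FF ?tF // eqxx.
(* The hypothesis passes to [fam :\ F]: the colon ideal contributes in degree [p], one lower, where
   the simplex has no homology because [d - #|F| < d - t <= p]. *)
case=> // p dp; apply: (exact_iff (fun x => iff_sym (adjE x))).
apply: exact_adjoin => //; first exact: ex.
apply: (exact_iff colE); apply: simplex.
rewrite ltnS in dp; apply: leq_trans dp.
by apply: ltn_sub2l => //; apply: leq_trans tF Fd.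
Qed.

End ElementarySymmetric.

(** * Ideals generated by sequences *)

Section IdealGen.
Variable R : comNzRingType.
Implicit Types (r : seq R) (x y z : R).

Lemma ideal_gen_subset r r' x : {subset r <= r'} -> ideal_gen r x -> ideal_gen r' x.
Proof.
move=> rr'; apply: ideal_gen_sub; first exact: ideal_gen_ideal.
by move=> y /rr'; apply: ideal_gen_mem.
Qed.

Lemma ideal_gen_rcons r x z : ideal_gen (rcons r x) z <-> adjoin (ideal_gen r) x z.
Proof.
have idr := ideal_gen_ideal r; have idrx := ideal_gen_ideal (rcons r x).
split=> [|[y rzy]].
  apply: ideal_gen_sub; first exact: adjoin_ideal.
  move=> y; rewrite mem_rcons inE => /orP[/eqP ->|yr].
    by rewrite -[X in adjoin _ _ X]mulr1; apply: adjoin_gen.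
  by apply/adjoin_sub/ideal_gen_mem.
rewrite -[z](subrK (x * y)); apply: idealD => //.
  by apply: ideal_gen_subset rzy => t tr; rewrite mem_rcons inE tr orbT.
by rewrite mulrC; apply/(idealM idrx)/ideal_gen_mem; rewrite mem_rcons mem_head.
Qed.

End IdealGen.

(** * The depth of [k[D]] from Koszul homology *)

Section SRDepth.
Variables (k : fieldType) (V : finType) (d : nat) (c : V -> 'I_d) (D : complex V).
Local Notation S := {mpoly k[#|V|]}.
Local Notation theta := (theta k c).
Local Notation sop := (sop k c).
Local Notation theta_esym := (theta_esym k c).
Local Notation theta_ix := (theta_ix d).
Local Notation esym_ix := (esym_ix d).
Local Notation I_ fam := (@monomial_ideal k V fam).
Hypothesis rb : rainbow c (faces D).

Definition SRpi : S -> SR_ring k D := \pi_({ideal_quot (@SR_ideal k V D)})%qT.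

Lemma SRpiB x y : SRpi (x - y) = SRpi x - SRpi y. Proof. exact: rmorphB. Qed.
Lemma SRpiD x y : SRpi (x + y) = SRpi x + SRpi y. Proof. exact: rmorphD. Qed.
Lemma SRpiM x y : SRpi (x * y) = SRpi x * SRpi y. Proof. exact: rmorphM. Qed.
Lemma SRpi0 : SRpi 0 = 0. Proof. exact: rmorph0. Qed.
Lemma SRpi1 : SRpi 1 = 1. Proof. exact: rmorph1. Qed.

Lemma SRpi_surj z : exists x, SRpi x = z.
Proof. by exists (repr z); apply: reprK. Qed.

Lemma SRpi_eq x y : SRpi x = SRpi y <-> I_ (faces D) (x - y).
Proof.
rewrite -SR_idealP Quotient.idealrBE; split=> [E|/eqP E //].
by apply/eqP.
Qed.

Lemma SRpi_eq0 x : SRpi x = 0 <-> I_ (faces D) x.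
Proof. by rewrite -SRpi0 SRpi_eq subr0. Qed.

Lemma SRpi_ideal (J : SR_ring k D -> Prop) : is_ideal J -> is_ideal (fun x => J (SRpi x)).
Proof.
case=> J0 cl; split; first by rewrite SRpi0.
by move=> a x y Jx Jy; rewrite SRpiD SRpiM; apply: cl.
Qed.

Lemma ideal_gen_SRpi (r : seq S) x : ideal_gen [seq SRpi y | y <- r] (SRpi x) ->
  exists2 z, ideal_gen r z & I_ (faces D) (x - z).
Proof.
have idr := ideal_gen_ideal r.
move=> gx; suff [z rz /SRpi_eq Iz]: exists2 z, ideal_gen r z & SRpi x = SRpi z by exists z.
apply: (ideal_gen_sub (J := fun w => exists2 z, ideal_gen r z & w = SRpi z)) gx.
  split=> [|a _ _ [x1 r1 ->] [x2 r2 ->]]; first by exists 0; rewrite ?SRpi0 //; apply: ideal0.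
  have [b <-] := SRpi_surj a; exists (b * x1 + x2); last by rewrite SRpiD SRpiM.
  by apply: idealD => //; apply: idealM.
by move=> _ /mapP[y yr ->]; exists y => //; apply: ideal_gen_mem.
Qed.

Let idI : is_ideal (I_ (faces D)).
Proof. by apply: monomial_ideal_ideal; apply: complex_down_closed. Qed.

Lemma SRmax_sub (K : S -> Prop) a : is_ideal K -> (forall x, I_ (faces D) x -> K x) ->
  (forall v, K (SR_var k v)) -> SR_max (SRpi a) -> K a.
Proof.
move=> idK IK Kx.
move=> maxa.
have : ideal_gen [seq SRpi y | y <- [seq SR_var k v | v : V]] (SRpi a) by rewrite -map_comp.
case/ideal_gen_SRpi=> z gz Iaz; rewrite -[a](subrK z); apply: idealD => //; first exact: IK.
by apply: (ideal_gen_sub idK) gz => _ /imageP[v _ ->].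
Qed.
(** By [exact_regular_nil], each regular element carries non-vanishing homology one degree up in the
    quotient; above degree [d] there is none. *)
Lemma SR_depth_upper p s : regular_in (@SR_max k V D) s ->
  ~ exact sop theta_ix (I_ (faces D)) p -> (p + size s <= d)%N.
Proof.
case=> -[reg _] smax nex.
(* The ideals of the initial segments of [s] are pulled back to the polynomial ring, where the
   Koszul chains live. *)
pose J j x := ideal_gen (take j s) (SRpi x).
have idJ j : is_ideal (J j) by apply/SRpi_ideal/ideal_gen_ideal.
have IJ j x : I_ (faces D) x -> J j x.
  by move=> /SRpi_eq0 x0; rewrite /J x0; exact: ideal0 (ideal_gen_ideal _).
suff step j : (j <= size s)%N -> ~ exact sop theta_ix (J j) (p + j).
  rewrite leqNgt; apply/negP=> ps; apply: (step (size s)) => //.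
  by apply: exact_gt => //; rewrite card_theta_ix.
elim: j => [|j IH] js exj.
  apply: nex; rewrite -[p]addn0; apply: exact_iff exj => x.
  split=> [|/IJ //]; rewrite /J take0 => -[e].
  by rewrite big_ord0 => /SRpi_eq0.
case: (IH (ltnW js)).
have [a sa] := SRpi_surj s`_j.
apply: (@exact_regular_nil _ _ sop V (@SR_var k V) a theta_ix (J j) (p + j) (idJ j)).
- move=> v K idK JK Kth; apply: (@sqr_vertex _ _ _ c (faces D) v K) => //.
    exact: complex_down_closed.
  by move=> y /IJ /JK.
- move=> K idK JK Kx.
  apply: (SRmax_sub idK) => //; first by move=> x /IJ /JK.
  by rewrite sa; apply: smax; apply: mem_nth.
- by move=> y; rewrite /J SRpiM sa; apply: reg.
- rewrite -addnS; apply: exact_iff exj => x.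
  rewrite /J (take_nth 0) // ideal_gen_rcons; split.
    case=> y' ; have [y <-] := SRpi_surj y'; rewrite -sa -SRpiM -SRpiB.
    by exists y.
  by case=> y Jy; exists (SRpi y); rewrite -sa -SRpiM -SRpiB.
Qed.

Lemma theta_esym_ideal (K : S -> Prop) n : is_ideal K -> (0 < n)%N ->
  (forall v, K (SR_var k v)) -> K (theta_esym n).
Proof.
move=> idK n0 Kx; apply: ideal_sum => // A /eqP An.
have /set0Pn[i iA] : A != set0 by rewrite -card_gt0 An.
rewrite (bigD1 i) //= mulrC; apply: idealM => //.
exact: ideal_sum.
Qed.

(** These are the polynomials without constant term, used to show that ideals are proper. *)
Lemma monomial_ideal_point : is_ideal (I_ [set set0]).
Proof.
apply: monomial_ideal_ideal => F G; rewrite !inE => /eqP ->.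
by rewrite subset0.
Qed.

(** Vanishing of H_1 for each initial segment gives the non-zero-divisor property by
    [exact1_regular]; the quotient is non-zero because no [theta_esym j.+1] has a constant term. *)
Lemma SR_depth_lower t : (t <= d)%N ->
  (forall p : nat, (d - t < p)%N -> exact sop theta_ix (I_ (faces D)) p) ->
  regular_in (@SR_max k V D) [seq SRpi (theta_esym j.+1) | j <- iota 0 t].
Proof.
move=> td ex; have dcD := complex_down_closed (D := D).
have exE j : (j <= t)%N -> forall q, (0 < q)%N ->
    exact sop (esym_ix j) (I_ (faces D)) q.
  move=> jt; apply: (@exact_esym_leq _ _ _ c _ t) => //; first by rewrite jt.
  exact: exact_esym.
split; last first.
  move=> _ /mapP[j _ ->].
  apply: (theta_esym_ideal (K := fun x => SR_max (SRpi x))) => // [|v].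
    exact/SRpi_ideal/ideal_gen_ideal.
  by apply: ideal_gen_mem; apply/imageP; exists v.
split=> [i|].
  rewrite size_map size_iota => it x'; have [x <-] := SRpi_surj x'.
  rewrite (nth_map 0%N) ?size_iota // nth_iota // add0n -SRpiM -map_take take_iota.
  rewrite (minn_idPl (ltnW it)).
  have -> : [seq SRpi (theta_esym j.+1) | j <- iota 0 i] =
            [seq SRpi y | y <- [seq theta_esym j.+1 | j <- iota 0 i]] by rewrite -map_comp.
  case/ideal_gen_SRpi=> z gz Iz.
  have id := leq_trans it td.
  pose a : 'I_d + 'I_d := inr (Ordinal id).
  have aE : a \notin esym_ix i by rewrite mem_esym_ix /= ltnn.
  have exa : exact sop (a |: esym_ix i) (I_ (faces D)) 1 by rewrite -esym_ixS; apply: exE.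
  apply: (exact1_regular idI aE exa (y := x) _ (K := fun y => ideal_gen _ (SRpi y))).
  - move=> K idK IK Ke; rewrite -[X in K X](subrK z); apply: idealD => //; first exact: IK.
    apply: (ideal_gen_sub idK) gz => _ /mapP[j ji ->]; rewrite mem_iota add0n in ji.
    have jd := ltn_trans ji id.
    by apply: (Ke (inr (Ordinal jd))); rewrite mem_esym_ix.
  - exact/SRpi_ideal/ideal_gen_ideal.
  - by move=> y /SRpi_eq0 ->; exact: ideal0 (ideal_gen_ideal _).
  - move=> [j|j]; rewrite mem_esym_ix // => ji; apply: ideal_gen_mem.
    by rewrite -map_comp; apply/mapP; exists (j : nat); rewrite ?mem_iota.
have -> : [seq SRpi (theta_esym j.+1) | j <- iota 0 t] =
          [seq SRpi y | y <- [seq theta_esym j.+1 | j <- iota 0 t]] by rewrite -map_comp.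
rewrite -SRpi1 => /ideal_gen_SRpi[z gz Iz].
have Iz0 : I_ [set set0] z.
  apply: (ideal_gen_sub monomial_ideal_point) gz => _ /mapP[j _ ->].
  rewrite -[theta_esym _]mulr1; apply: theta_esym_in_ideal => F.
  by rewrite inE => /eqP ->; rewrite cards0.
have := Iz 0%MM; rewrite mvert0 complex_set0 mcoeffB (Iz0 0%MM) ?mvert0 ?inE // subr0.
by rewrite mcoeff1 eqxx => /(_ isT)/eqP; rewrite oner_eq0.
Qed.

Theorem SR_depth_eq p : (p <= d)%N -> ~ exact sop theta_ix (I_ (faces D)) p ->
  (forall q, (p < q)%N -> exact sop theta_ix (I_ (faces D)) q) ->
  SR_depth k D = (d - p)%N.
Proof.
move=> pd nex ex.
have ub s : regular_in (@SR_max k V D) s -> (size s <= d - p)%N.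
  by move=> /SR_depth_upper/(_ nex); rewrite leq_subRL.
have dP : is_depth (@SR_max k V D) (d - p).
  split=> //; exists [seq SRpi (theta_esym j.+1) | j <- iota 0 (d - p)].
    by apply: SR_depth_lower => [|q]; rewrite ?leq_subr // subKn //; apply: ex.
  by rewrite size_map size_iota.
(* [is_depth] determines its number, so [xget] returns [d - p] and not the default value. *)
apply: classical_sets.xget_unique => // n [[s sr sn] nub]; apply/eqP.
case: dP => [[s' sr' sn'] _]; rewrite eqn_leq -{1}sn -{2}sn' (ub _ sr) /=.
exact: nub.
Qed.

(** H_0 is non-zero, as neither the color sums nor the ideal of [D] contribute a constant term. *)
Lemma not_exact0 : ~ exact sop theta_ix (I_ (faces D)) 0.
Proof.
move/(_ (kpoint _ 1) (@kin_kpoint _ _ _ _)).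
rewrite (kdiff_kin0 _ (@kin_kpoint _ _ theta_ix 1)) => /(_ (inJ0 idI)) bH.
have {bH} := iffLR (bnd_kpointP sop theta_ix 1 idI) bH.
move/(_ (I_ [set set0]) monomial_ideal_point) => H.
have/(_ 0%MM): I_ [set set0] 1.
  apply: H => [x Ix m|_ /theta_ixP[j ->] m].
    by rewrite inE => /eqP m0; apply: Ix; rewrite m0 complex_set0.
  rewrite inE => /eqP m0; rewrite /= -[theta j]mulr1 mcoeff_thetaM.
  by rewrite big_pred0 // => v; rewrite m0 inE andbF.
by rewrite mvert0 inE eqxx mcoeff1 eqxx => /(_ isT)/eqP; rewrite oner_eq0.
Qed.

End SRDepth.

(** * Simplicial cochains: vanishing homology gives vanishing cohomology *)

Section CohomologyVanishing.
Variables (k : fieldType) (V : finType) (D : complex V).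
Implicit Types (F G : {set V}) (u v : V) (phi chi : {set V} -> k).

Definition face_sign v F : k := (-1) ^+ #|[set u in F | (enum_rank u < enum_rank v)%N]|.

Definition coboundary phi F : k := \sum_(v in F) face_sign v F * phi (F :\ v).

Lemma faces_dimP (t : nat) F : (F \in faces_dim D (t%:Z - 1)) = (F \in faces D) && (#|F| == t).
Proof. by rewrite inE subrK. Qed.

Lemma faces_dim_pred (i : int) F : F \in faces_dim D (i + 1) -> forall v, v \in F ->
  F :\ v \in faces_dim D i.
Proof.
rewrite inE => /andP[FD Fi] v vF; rewrite inE; apply/andP; split.
  exact: complex_sub FD (subD1set F v).
by move: Fi; rewrite (cardsD1 v) vF add1n -natz mulrS addrC natz (inj_eq (addIr _)).
Qed.

Lemma sum_incidence (i j : int) (F : {F : {set V} | F \in faces_dim D i}) phi :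
  i = j + 1 ->
  \sum_(G : {G : {set V} | G \in faces_dim D j}) incidence k (val F) (val G) * phi (val G)
  = coboundary phi (val F).
Proof.
move=> ij; rewrite /incidence /coboundary.
under eq_bigr do rewrite mulr_suml big_mkcondr.
rewrite exchange_big; apply: eq_bigr => v vF /=.
have FD : val F :\ v \in faces_dim D j by apply: faces_dim_pred vF; rewrite -ij; apply: valP.
pose G0 : {G : {set V} | G \in faces_dim D j} := exist _ (val F :\ v) FD.
rewrite (bigD1 G0) //= eqxx big1 ?addr0 // => G GF.
by case: eqP => // E; rewrite -val_eqE /= E eqxx in GF.
Qed.

Variable phi : {set V} -> k.

Definition pairing (i : int) (z : chains k D i) : k^o := \sum_F z F * phi (val F).

Fact pairing_linear i : linear (@pairing i).
Proof.
move=> a y z; rewrite /pairing scaler_sumr -big_split /=; apply: eq_bigr => F _.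
by rewrite !ffunE mulrDl -scalerAl.
Qed.

HB.instance Definition _ i :=
  GRing.isLinear.Build k (chains k D i) k^o _ (@pairing i) (@pairing_linear i).

Definition chain_delta (i : int) (F : {F : {set V} | F \in faces_dim D i}) : chains k D i :=
  [ffun G => (G == F)%:R].

Lemma chain_deltaE i (z : chains k D i) : z = \sum_F z F *: chain_delta F.
Proof.
apply/ffunP=> G; rewrite sum_ffunE (bigD1 G) //= !ffunE eqxx.
rewrite big1 ?addr0 => [|F /negPf FG]; first by rewrite [RHS]mulr1.
by rewrite !ffunE eq_sym FG [LHS]mulr0.
Qed.

Lemma pairing_delta i (F : {F : {set V} | F \in faces_dim D i}) :
  pairing (@chain_delta i F) = phi (val F).
Proof.
rewrite /pairing (bigD1 F) //= ffunE eqxx mul1r big1 ?addr0 // => G /negPf GF.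
by rewrite ffunE GF mul0r.
Qed.

(* Dual of the universal coefficient statement: a functional on chains that kills
   boundaries, hence cycles, factors through the boundary map. *)
Lemma coboundary_exact (t : nat) :
  (forall h : reduced_homology k D (t%:Z - 1), h = 0) ->
  (forall F, F \in faces D -> #|F| = t.+1 -> coboundary phi F = 0) ->
  exists chi, forall F, F \in faces D -> #|F| = t -> phi F = coboundary chi F.
Proof.
set i := t%:Z - 1 => H0 cocycle.
pose bd := boundary k D i (i - 1).
have cycle_bd z : z \in cycles k D i -> z \in boundaries k D i.
  move=> zc; pose w : subvs_of (cycles k D i) := Subvs zc.
  have : w - 0 \in @is_boundary k V D i.
    by rewrite Quotient.idealrBE; apply/eqP; rewrite [LHS]H0 [RHS]H0.
  by rewrite subr0.
have pair0 z : z \in boundaries k D i -> pairing z = 0.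
  case/memv_imgP=> y _ ->; rewrite lfunE /= /pairing.
  under eq_bigr do rewrite ffunE mulr_suml.
  rewrite exchange_big big1 //= => F _.
  under eq_bigr do rewrite -mulrA.
  rewrite -mulr_sumr (@sum_incidence _ i) // cocycle ?mulr0 //.
    by have := valP F; rewrite inE => /andP[].
  move: (val F) (valP F) => F1; rewrite inE /i subrK => /andP[_].
  by rewrite -[1]/(1%:Z) -PoszD addn1 => /eqP[].
(* The cochain is [phi] composed with a linear pseudo-inverse of the boundary map, extended by 0 to
   the other sets. *)
exists (fun G => if insub G is Some G' then pairing (bd^-1%VF (chain_delta G')) else 0).
move=> F FD Ft.
have FP : F \in faces_dim D i by rewrite faces_dimP FD Ft eqxx.
pose F' : {F : {set V} | F \in faces_dim D i} := Sub F FP.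
have -> : F = val F' by rewrite SubK.
rewrite -(@sum_incidence i (i - 1)) ?subrK //.
under eq_bigr do rewrite valK.
have -> : \sum_(G : {G | G \in faces_dim D (i - 1)}) incidence k (val F') (val G) *
    pairing (bd^-1%VF (chain_delta G)) = pairing (bd^-1%VF (bd (chain_delta F'))).
  rewrite [in RHS](chain_deltaE (bd _)) !linear_sum /=; apply: eq_bigr => G _.
  rewrite !linearZ /= lfunE ffunE /=; congr (_ * _).
  rewrite (bigD1 F') //= ffunE eqxx mul1r big1 ?addr0 // => F1 /negPf F1F.
  by rewrite ffunE F1F mul0r.
(* A chain minus the pseudo-inverse of its boundary is a cycle, hence a boundary, and the pairing
   vanishes on it. *)
rewrite -pairing_delta; apply/eqP; rewrite -subr_eq0 -linearB /=; apply/eqP/pair0/cycle_bd.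
rewrite /cycles memv_ker linearB /= -/bd limg_lfunVK ?subrr //.
exact: memv_img (memvf _).
Qed.

End CohomologyVanishing.

(** * Comparison of simplicial and Koszul signs *)

Section Signs.
Variables (k : fieldType) (V : finType) (d : nat) (c : V -> 'I_d).
Implicit Types (F G : {set V}) (u v w : V).
Local Notation theta_ix := (theta_ix d).
Local Notation rank i := (enum_rank i : nat).

(* The face [F] contributes to Koszul chains in the degrees where the colors of [F]
   are missing. *)
Definition missing F : {set 'I_d + 'I_d} := [set inl j | j in ~: (c @: F)].

Lemma mem_missing F j : (inl j \in missing F) = (j \notin c @: F).
Proof. by rewrite mem_imset ?inE //; apply: inl_inj. Qed.

Lemma missing_sub F : missing F \subset theta_ix.
Proof. by apply/subsetP=> _ /imsetP[j _ ->]; apply: inl_theta_ix. Qed.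

Lemma missingD1 F v : {in F &, injective c} -> v \in F ->
  missing (F :\ v) = inl (c v) |: missing F.
Proof.
move=> inj vF; apply/setP=> -[j|j]; last first.
  rewrite !inE /=; apply/idP/idP => [/(subsetP (missing_sub _))/theta_ixP[] //|].
  by case/(subsetP (missing_sub _))/theta_ixP.
rewrite mem_missing !inE mem_missing; apply/idP/idP => [nj|].
  have [->|jv] := eqVneq j (c v); first by rewrite eqxx.
  apply/orP; right; apply: contra nj => /imsetP[u uF E].
  by apply/imsetP; exists u => //; rewrite !inE uF andbT; apply: contraNneq jv => <-; rewrite E.
case/orP => [/eqP[->]|]; last by apply: contra => /imsetP[u /setD1P[_ uF] ->]; apply: imset_f.
by apply/imsetP => -[u /setD1P[uv uF] /inj E]; rewrite E ?eqxx in uv.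
Qed.

Lemma sign_card (A : finType) (B : {set A}) (Q : pred A) :
  (-1) ^+ #|[set u in B | Q u]| = \prod_(u in B) (-1) ^+ (Q u) :> k.
Proof.
rewrite -sum1_card -prodrXr /= big_mkcond [RHS]big_mkcond /=.
by apply: eq_bigr => u _; rewrite inE; case: (u \in B); case: (Q u).
Qed.

Definition inversion u w : bool :=
  (rank u < rank w)%N && (rank (inl (c w) : 'I_d + 'I_d) < rank (inl (c u) : 'I_d + 'I_d))%N.

(* The discrepancy between orienting [F] by the enumeration of [V] and orienting the
   set of missing colors by the enumeration of the Koszul indices. *)
Definition orient F : k :=
  \prod_(u in F) ((-1) ^+ #|[set j in theta_ix | rank j < rank (inl (c u) : 'I_d + 'I_d)]%N|
                  * \prod_(w in F) (-1) ^+ inversion u w).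

Lemma orient_sqr F : orient F * orient F = 1.
Proof.
rewrite /orient -big_split big1 //= => u uF.
rewrite mulrACA -expr2 sqrr_sign mul1r -big_split big1 //= => w _.
by rewrite -expr2 sqrr_sign.
Qed.

(** The indices before the color of [v] are either missing colors, which give the Koszul sign, or
    colors of [F]. For each [u] in [F :\ v], the latter combine with the inversions between [u] and
    [v] to -1 exactly when [u] precedes [v], which gives the face sign. *)
Lemma orientD1 F v : {in F &, injective c} -> v \in F ->
  orient F = koszul_sign k (inl (c v)) (missing F) * face_sign k v F * orient (F :\ v).
Proof.
move=> inj vF; rewrite [LHS](big_setD1 v) //=.
have -> : \prod_(u in F :\ v)
    ((-1) ^+ #|[set j in theta_ix | rank j < rank (inl (c u) : 'I_d + 'I_d)]%N|
        * \prod_(w in F) (-1) ^+ inversion u w)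
    = (\prod_(u in F :\ v) (-1) ^+ inversion u v) * orient (F :\ v).
  rewrite /orient -big_split; apply: eq_bigr => u _ /=.
  by rewrite [\prod_(w in F) _](big_setD1 v) //= mulrCA.
rewrite mulrA; congr (_ * _).
rewrite (big_setD1 v) //= /inversion ltnn expr0 mul1r -/inversion.
rewrite /koszul_sign /face_sign !sign_card.
rewrite (big_imset _ (in2W (@inl_inj _ _))) /= (big_imset _ (in2W (@inl_inj _ _))) /=.
rewrite (bigID (mem (c @: F))) /= big_imset //= -mulrA [LHS]mulrC -[RHS]mulrC.
rewrite [LHS]mulrA; congr (_ * _); last by apply: eq_bigl => j; rewrite inE.
rewrite !(big_setD1 v vF) /= !ltnn !expr0 !mul1r -!big_split /=; apply: eq_bigr => u.
rewrite !inE => /andP[uv uF].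
have cuv : c u != c v by apply: contraNneq uv => /inj ->.
have ruv : rank u != rank v by rewrite (inj_eq val_inj) (inj_eq enum_rank_inj).
have pcuv : rank (inl (c u) : 'I_d + 'I_d) != rank (inl (c v) : 'I_d + 'I_d).
  by rewrite (inj_eq val_inj) (inj_eq enum_rank_inj).
case: (ltngtP (rank u) (rank v)) ruv => //;
  case: (ltngtP (rank (inl (c u) : 'I_d + 'I_d)) (rank (inl (c v) : 'I_d + 'I_d))) pcuv => //=;
  by rewrite ?expr0 ?expr1 ?mulr1 ?mul1r ?mulN1r ?opprK.
Qed.

End Signs.

(** * The squarefree strand of the Koszul complex as a cochain complex *)

Section Strand.
Variables (k : fieldType) (V : finType) (d : nat) (c : V -> 'I_d) (D : complex V).
Local Notation mono := 'X_{1..#|V|}.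
Local Notation S := {mpoly k[#|V|]}.
Local Notation theta_ix := (theta_ix d).
Local Notation sop := (sop k c).
Local Notation missing := (missing c).
Local Notation orient := (orient k c).
Local Notation I_ fam := (@monomial_ideal k V fam).
Implicit Types (m : mono) (F G : {set V}) (u v : V) (T : {set 'I_d + 'I_d}).
Implicit Types (f g : kchain S ('I_d + 'I_d)%type) (phi chi : {set V} -> k).
Hypothesis rb : rainbow c (faces D).

Let idI : is_ideal (I_ (faces D)).
Proof. by apply: monomial_ideal_ideal; apply: complex_down_closed. Qed.

(** Each face [F] is placed at the basis vector of its missing colors, so that every color occurs
    exactly once in the monomial and the basis vector together: this is the strand of color degree
    (1,...,1). *)
Definition face_chain phi : kchain S _ :=
  [ffun T : {set 'I_d + 'I_d} => \sum_(F in faces D | missing F == T) phi F *: 'X_[mface F]].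

Definition color_coboundary phi F : k :=
  \sum_(v in F) koszul_sign k (inl (c v)) (missing F) * phi (F :\ v).

Lemma mcoeff_face_chain phi T m : (face_chain phi T)@_m =
  if [&& mvert m \in faces D, missing (mvert m) == T & m == mface (mvert m)]
  then phi (mvert m) else 0.
Proof.
rewrite ffunE linear_sum /=.
under eq_bigr do rewrite mcoeffZ mcoeffX.
case: ifP => [/and3P[FD FT /eqP mF]|nF].
  rewrite (bigD1 (mvert m)) ?FD ?FT //= -mF eqxx mulr1 big1 ?addr0 // => F /andP[_ Fm].
  case: eqP => [E|_]; last by rewrite mulr0.
  by rewrite -E mvert_face eqxx in Fm.
rewrite big1 // => F /andP[FD FT]; case: eqP => [E|]; last by rewrite mulr0.
by rewrite -E mvert_face FD FT eqxx in nF.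
Qed.

Lemma mcoeff_kdiff f T m : (kdiff sop theta_ix f T)@_m =
  \sum_(v in mvert m) if inl (c v) \in T then 0
    else koszul_sign k (inl (c v)) T * (f (inl (c v) |: T))@_(m - mvar v).
Proof.
rewrite kdiffE linear_sum /= (big_imset _ (in2W (@inl_inj _ _))) /=.
rewrite [RHS](partition_big c predT) //=; apply: eq_big => [j|j _]; first by rewrite inE.
rewrite ffunE; case: ifP => jT.
  by rewrite mulr0 mcoeff0 big1 // => v /andP[_ /eqP ->]; rewrite jT.
rewrite mulrCA /koszul_sign (raddfMsign (mcoeff m)).
rewrite [X in _ * X](mcoeff_thetaM c j (f (inl j |: T)) m) mulr_sumr.
apply: eq_big => [v|v /andP[/eqP -> _]]; first by rewrite andbC.
by rewrite jT.
Qed.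

Lemma kdiff_face_chain chi T m : mvert m \in faces D ->
  (kdiff sop theta_ix (face_chain chi) T)@_m = (face_chain (color_coboundary chi) T)@_m.
Proof.
move=> mD; rewrite mcoeff_kdiff mcoeff_face_chain mD /=; set F := mvert m.
have inj := rb mD.
suff term v : v \in F -> (if inl (c v) \in T then 0
    else koszul_sign k (inl (c v)) T * (face_chain chi (inl (c v) |: T))@_(m - mvar v))
  = if (missing F == T) && (m == mface F) then koszul_sign k (inl (c v)) T * chi (F :\ v) else 0.
  rewrite (eq_bigr _ term); case: ifP => [/andP[/eqP <- _] //|_].
  by rewrite big1.
move=> vF; rewrite mcoeff_face_chain; set G := mvert (m - mvar v).
have GD : G \in faces D by apply: complex_sub mD (mvertB _ _).
rewrite GD /=.
case: (boolP ((missing F == T) && (m == mface F))) => [/andP[/eqP FT /eqP mF]|].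
  have mvE : (m - mvar v)%MM = mface (F :\ v).
    apply: mexpP => w; rewrite mexpB {1}mF !mexp_face mexp_var in_setD1 (eq_sym w v).
    by case: (eqVneq v w) => [<-|]; rewrite ?vF //= ?subn0.
  have GE : G = F :\ v by rewrite /G mvE mvert_face.
  rewrite -FT mem_missing imset_f //= GE mvE eqxx missingD1 // eqxx.
  by [].
case: ifP => // vT; case: ifP; rewrite ?mulr0 // => /andP[/eqP GT /eqP mG].
have vG : v \notin G.
  have : inl (c v) \in missing G by rewrite GT setU11.
  by rewrite mem_missing; apply: contra; apply: imset_f.
have mE : m = (mface G + mvar v)%MM by rewrite -mG submK // mvar_le.
have FE : F = v |: G by rewrite /F mE mvertD mvert_face mvert_var setUC.
have GF : G = F :\ v by rewrite FE setU1K.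
case/negP; apply/andP; split; apply/eqP.
  apply/setP=> i; have := congr1 (fun A : {set _} => i \in A) GT.
  rewrite GF missingD1 // !inE; case: eqP => [->|//]; rewrite vT => _.
  by apply/negbTE; rewrite mem_missing negbK; apply: imset_f.
apply: mexpP => w; rewrite FE mE mexpD !mexp_face mexp_var in_setU1 (eq_sym w v).
by case: (eqVneq v w) vG => [<- /negPf ->|]; rewrite ?addn0.
Qed.

(** Rescaling by [orient] identifies the Koszul differential on the strand with the simplicial
    coboundary. *)
Lemma coboundary_orient phi F : F \in faces D ->
  coboundary (fun G => orient G * phi G) F = orient F * color_coboundary phi F.
Proof.
move=> FD; rewrite /coboundary mulr_sumr; apply: eq_bigr => v vF.
rewrite (orientD1 k (rb FD) vF) !mulrA; congr (_ * _).
rewrite [RHS]mulrC !mulrA; congr (_ * _).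
by rewrite /koszul_sign -expr2 sqrr_sign mul1r.
Qed.

Lemma card_missing F : F \in faces D -> (#|missing F| + #|F| = d)%N.
Proof.
move=> FD; rewrite card_imset; last exact: inl_inj.
by rewrite addnC -(card_in_imset (rb FD)) cardsC card_ord.
Qed.

(** Modulo the ideal, [f] is a cocycle on the faces with [d - p] vertices, those missing [p] colors;
    the homology hypothesis makes it a coboundary. *)
Lemma strand_exact p f : (p <= d)%N ->
  (forall h : reduced_homology k D ((d - p)%N%:Z - 1), h = 0) ->
  kin theta_ix p f -> inJ (I_ (faces D)) (kdiff sop theta_ix f) ->
  (forall T m, mvert m \in faces D -> (f T)@_m != 0 ->
     m = mface (mvert m) /\ T = missing (mvert m)) ->
  bnd sop theta_ix (I_ (faces D)) f.
Proof.
move=> pd H0 Kf Jf sup.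
pose phi F := (f (missing F))@_(mface F).
have Jphi : inJ (I_ (faces D)) (f - face_chain phi).
  move=> T m mD; have -> : (f - face_chain phi) T = f T - face_chain phi T by rewrite !ffunE.
  rewrite mcoeffB mcoeff_face_chain mD /=.
  case: ifPn => [/andP[/eqP <- /eqP mF]|]; first by rewrite /phi -mF subrr.
  rewrite subr0; apply: contraNeq => /(sup T m mD)[{1}<- ->].
  by rewrite !eqxx.
have phi0 F : F \in faces D -> color_coboundary phi F = 0.
  move=> FD; have := inJ_diff sop idI theta_ix Jphi; rewrite raddfB /= => Jd.
  have := inJB idI Jf Jd; rewrite opprB addrC subrK => /(_ (missing F) (mface F)).
  rewrite mvert_face => /(_ FD).
  by rewrite kdiff_face_chain ?mcoeff_face_chain ?mvert_face // FD !eqxx.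
have [|chi chiE] := coboundary_exact (phi := fun F => orient F * phi F) H0.
  by move=> F FD _; rewrite coboundary_orient // phi0 // mulr0.
(* The cochain is cut down to the faces with one vertex fewer than [d - p], so that its coboundary
   vanishes, like [phi], on faces of any other size. *)
pose chi' G := if #|G|.+1 == (d - p)%N then orient G * chi G else 0.
have dchi F : F \in faces D -> color_coboundary chi' F = phi F.
  move=> FD; have [Fp|Fp] := eqVneq #|F| (d - p)%N; last first.
    rewrite /color_coboundary big1 => [|v vF].
      apply/esym; rewrite /phi Kf ?mcoeff0 // missing_sub /=; apply: contra Fp => /eqP Fp.
      by rewrite -(card_missing FD) Fp addKn.
    by rewrite /chi' -[_.+1]add1n -[1%N]/(true : nat) -vF -cardsD1 (negPf Fp) mulr0.
  rewrite -[LHS]mul1r -[RHS]mul1r -(orient_sqr k c F) -!mulrA -coboundary_orient // chiE //.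
  congr (_ * _); apply: eq_bigr => v vF; congr (_ * _).
  by rewrite /chi' -[_.+1]add1n -[1%N]/(true : nat) -vF -cardsD1 Fp eqxx mulrA orient_sqr mul1r.
exists (face_chain chi') => T m mD; have := Jphi T m mD.
have subE (g h : kchain S ('I_d + 'I_d)%type) : (g - h) T = g T - h T by rewrite !ffunE.
by rewrite !subE !mcoeffB kdiff_face_chain // !mcoeff_face_chain dchi.
Qed.

End Strand.

(** * Koszul chains under ring morphisms *)

Section KoszulMap.
Variables (R R' : comNzRingType) (I : finType) (h : {rmorphism R -> R'}).
Implicit Types (f : kchain R I) (X T : {set I}).

Definition kmap f : kchain R' I := [ffun T : {set I} => h (f T)].

Lemma kmap_ann i f : kmap (ann i f) = ann i (kmap f).
Proof.
apply/ffunP=> T; rewrite !ffunE; case: ifP => _; first exact: rmorph0.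
by rewrite rmorphM rmorphXn rmorphN1.
Qed.

Lemma kmapB f g : kmap (f - g) = kmap f - kmap g.
Proof. by apply/ffunP=> T; rewrite !ffunE rmorphB. Qed.

Lemma kmapD f g : kmap (f + g) = kmap f + kmap g.
Proof. by apply/ffunP=> T; rewrite !ffunE rmorphD. Qed.

Lemma kmap_scale b f : kmap (kscale b f) = kscale (h b) (kmap f).
Proof. by apply/ffunP=> T; rewrite !ffunE rmorphM. Qed.

Lemma kin_kmap X p f : kin X p f -> kin X p (kmap f).
Proof. by move=> Kf T nT; rewrite ffunE Kf // rmorph0. Qed.

Lemma kmap_diff (s : I -> R) (s' : I -> R') X f :
  (forall i, i \in X -> h (s i) = s' i) -> kmap (kdiff s X f) = kdiff s' X (kmap f).
Proof.
move=> hs; apply/ffunP=> T; rewrite ffunE !kdiffE rmorph_sum; apply: eq_bigr => i iX.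
by rewrite rmorphM hs // -kmap_ann [in RHS]ffunE.
Qed.

End KoszulMap.

(** * The complex induced on the vertices not of color [i] *)

Section InducedComplex.
Variables (k : fieldType) (V : finType) (d : nat) (c : V -> 'I_d) (D : complex V).
Variables (i : 'I_d) (A : {set V}).
Hypothesis rb : rainbow c (faces D).
Hypothesis memA : forall v, (v \in A) = (c v != i).
Local Notation W := {v : V | v \in A}.
Local Notation mono := 'X_{1..#|V|}.
Local Notation S := {mpoly k[#|V|]}.
Local Notation SA := {mpoly k[#|{: W}|]}.
Local Notation DA := (induced D A).
Local Notation cA := (fun w : W => c (val w)).
Local Notation theta_ix := (theta_ix d).
Local Notation sopA := (sop k cA).
Local Notation sop := (sop k c).
Local Notation a := (inl i : 'I_d + 'I_d).
Local Notation X0 := (theta_ix :\ a).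
Local Notation I_ D := (@monomial_ideal k _ (faces D)).
Implicit Types (m : mono) (u v : V) (w : W).

Definition embed : {rmorphism SA -> S} :=
  comp_mpoly [tuple SR_var k (val (enum_val j)) | j < #|{: W}|].

(** Variables outside [A] are sent to 0. With [embed] this makes the Stanley-Reisner ring of the
    induced complex a retract of that of [D]. *)
Definition restrict : {rmorphism S -> SA} :=
  comp_mpoly [tuple oapp (@SR_var k W) 0 (insub (enum_val j)) | j < #|V|].

Lemma embed_var w : embed (SR_var k w) = SR_var k (val w).
Proof. by rewrite /embed /= comp_mpolyXU -tnth_nth tnth_mktuple enum_rankK. Qed.

Lemma restrict_var v : restrict (SR_var k v) = oapp (@SR_var k W) 0 (insub v).
Proof. by rewrite /restrict /= comp_mpolyXU -tnth_nth tnth_mktuple enum_rankK. Qed.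

Lemma rainbow_induced : rainbow cA (faces DA).
Proof.
move=> F; rewrite inE => FD u v uF vF /= E; apply: val_inj.
by apply: (rb FD) E; apply: imset_f.
Qed.

Let idI : is_ideal (I_ D).
Proof. by apply: monomial_ideal_ideal; apply: complex_down_closed. Qed.

Let idIA : is_ideal (I_ DA).
Proof. by apply: monomial_ideal_ideal; apply: complex_down_closed. Qed.

Lemma preimage_ideal (R R' : comNzRingType) (h : {rmorphism R -> R'}) (J : R' -> Prop) :
  is_ideal J -> is_ideal (fun x => J (h x)).
Proof.
case=> J0 cl; split; first by rewrite rmorph0.
by move=> b x y Jx Jy; rewrite rmorphD rmorphM; apply: cl.
Qed.

Lemma embed_ideal p : I_ DA p -> I_ D (embed p).
Proof.
apply: (monomial_ideal_gen (J := fun p => I_ D (embed p))).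
  exact: preimage_ideal.
move=> F FD; rewrite rmorph_prod (eq_bigr (fun w => SR_var k (val w))); last first.
  by move=> w _; apply: embed_var.
rewrite -(big_imset _ (in2W val_inj)) /= prod_SR_var; apply: monomial_ideal_X.
by rewrite mvert_face; apply: contra FD; rewrite inE.
Qed.

Lemma restrict_ideal p : I_ D p -> I_ DA (restrict p).
Proof.
apply: (monomial_ideal_gen (J := fun p => I_ DA (restrict p))).
  exact: preimage_ideal.
move=> F FD; rewrite rmorph_prod.
have [FA|/subsetPn[v vF vA]] := boolP (F \subset A); last first.
  rewrite (bigD1 v) //= restrict_var insubN // mul0r; exact: ideal0.
have FE : F = val @: [set w : W | val w \in F].
  apply/setP=> v; apply/idP/imsetP => [vF|[w + ->]]; last by rewrite inE.
  by exists (Sub v (subsetP FA v vF)); rewrite ?inE SubK.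
rewrite FE (big_imset _ (in2W val_inj)) /=.
rewrite (eq_bigr (fun w => SR_var k w)); last by move=> w _; rewrite restrict_var valK.
rewrite prod_SR_var; apply: monomial_ideal_X.
by rewrite mvert_face inE -FE.
Qed.

Lemma restrict_theta j : restrict (theta k c j) = theta k cA j.
Proof.
rewrite rmorph_sum /theta (bigID (mem A)) /= [X in _ + X]big1 ?addr0; last first.
  by move=> v /andP[_ vA]; rewrite restrict_var insubN.
rewrite (reindex_omap val (insub : V -> option W)) /=; last first.
  by move=> v /andP[_ vA]; rewrite insubT.
apply: eq_big => [w|w _]; last by rewrite restrict_var valK.
by rewrite valK eqxx andbT (valP w) andbT.
Qed.

Lemma embed_theta j : j != i -> embed (theta k cA j) = theta k c j.
Proof.
move=> ji; rewrite rmorph_sum /theta [RHS](reindex_omap val (insub : V -> option W)) /=.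
  apply: eq_big => [w|w _]; last exact: embed_var.
  by rewrite valK eqxx andbT.
by move=> v /eqP cv; rewrite insubT // memA cv.
Qed.

Lemma theta_induced0 : theta k cA i = 0.
Proof. by rewrite /theta big_pred0 // => w; apply/negbTE; rewrite -memA; apply: valP. Qed.

Lemma monomial_prod (U : finType) (m : 'X_{1..#|U|}) :
  'X_[m] = \prod_(v : U) SR_var k v ^+ mexp m v.
Proof.
rewrite mpolyXE_id (reindex enum_rank) //=.
by apply: onW_bij; apply: enum_rank_bij.
Qed.

Lemma embedZ b p : embed (b *: p) = b *: embed p.
Proof. exact: comp_mpolyZ. Qed.

Lemma restrictZ b p : restrict (b *: p) = b *: restrict p.
Proof. exact: comp_mpolyZ. Qed.

Lemma embedK p : restrict (embed p) = p.
Proof.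
rewrite [p in LHS]mpolyE [RHS]mpolyE (rmorph_sum embed) (rmorph_sum restrict).
apply: eq_bigr => m _; rewrite embedZ restrictZ monomial_prod !rmorph_prod.
congr (_ *: _); apply: eq_bigr => w _.
by rewrite !rmorphXn embed_var restrict_var valK.
Qed.

Lemma mcoeff_embed_restrict p m :
  (embed (restrict p))@_m = if mvert m \subset A then p@_m else 0.
Proof.
have mX (m1 : mono) : embed (restrict 'X_[m1]) = if mvert m1 \subset A then 'X_[m1] else 0.
  have var v : embed (restrict (SR_var k v)) = if v \in A then SR_var k v else 0.
    rewrite restrict_var; case: ifPn => vA; last by rewrite insubN // rmorph0.
    by rewrite insubT /= embed_var SubK.
  rewrite monomial_prod !rmorph_prod; case: ifPn => [mA|/subsetPn[v vm vA]].
    apply: eq_bigr => v _; rewrite !rmorphXn var.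
    case: ifPn => // vA; have: v \notin mvert m1 by apply: contra vA; apply: subsetP.
    by rewrite inE negbK => /eqP ->; rewrite !expr0.
  rewrite (bigD1 v) //= !rmorphXn var (negPf vA) expr0n.
  by rewrite inE in vm; rewrite (negPf vm) mul0r.
rewrite [p in LHS]mpolyE (rmorph_sum restrict) (rmorph_sum embed) (raddf_sum (mcoeff m)) /=.
case: ifPn => mA; [rewrite [p in RHS]mpolyE (raddf_sum (mcoeff m)); apply: eq_bigr | rewrite big1 //];
  move=> m1 _; rewrite restrictZ embedZ /= !mcoeffZ -/(embed _) mX; case: ifPn => m1A //.
  rewrite mcoeff0 mcoeffX; case: eqP => [E|//]; by rewrite E mA in m1A.
- rewrite mcoeffX; case: eqP => [E|_]; last by rewrite mulr0.
  by rewrite -E m1A in mA.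
by rewrite mcoeff0 mulr0.
Qed.

Lemma color_notin : a \notin X0. Proof. by rewrite !inE eqxx. Qed.

Lemma colorU1 : a |: X0 = theta_ix. Proof. by rewrite setD1K // inl_theta_ix. Qed.

Lemma sop_embed j : j \in X0 -> embed (sopA j) = sop j.
Proof.
rewrite !inE => /andP[ja /theta_ixP[j' jE]]; rewrite jE /= embed_theta //.
by apply: contraNneq ja => <-; rewrite jE.
Qed.

Lemma sop_restrict j : j \in theta_ix -> restrict (sop j) = sopA j.
Proof. by case/theta_ixP=> j' ->; apply: restrict_theta. Qed.

Lemma kdiff_induced (g : kchain SA ('I_d + 'I_d)%type) :
  kdiff sopA theta_ix g = kdiff sopA X0 g.
Proof.
rewrite -[in LHS]colorU1 kdiffU1 ?color_notin //= theta_induced0.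
have -> : kscale 0 (ann a g) = 0 by apply/ffunP=> T; rewrite !ffunE mul0r.
by rewrite add0r.
Qed.

Lemma kdiff_free (f : kchain S ('I_d + 'I_d)%type) : ann a f = 0 ->
  kdiff sop theta_ix f = kdiff sop X0 f.
Proof. by move=> af; rewrite -[in LHS]colorU1 kdiffU1 ?color_notin // af raddf0 add0r. Qed.

Lemma inJ_embed (g : kchain SA ('I_d + 'I_d)%type) :
  inJ (I_ DA) g -> inJ (I_ D) (kmap embed g).
Proof. by move=> Jg T; rewrite ffunE; apply: embed_ideal. Qed.

Lemma inJ_restrict (f : kchain S ('I_d + 'I_d)%type) :
  inJ (I_ D) f -> inJ (I_ DA) (kmap restrict f).
Proof. by move=> Jf T; rewrite ffunE; apply: restrict_ideal. Qed.

(** A cycle is embedded, bounded over [D] and restricted back. The bounding chain may involve color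
    [i], but restriction sends [theta i] to 0. *)
Lemma induced_exact_colors q :
  exact sop theta_ix (I_ D) q -> exact sopA X0 (I_ DA) q.
Proof.
move=> ex u Ku Ju; have Kf : kin X0 q (kmap embed u) by apply: kin_kmap.
have [||g Jg] := ex (kmap embed u); first by apply: kinW Kf; apply: subD1set.
  rewrite kdiff_free; last exact: ann_notin color_notin Kf.
  by rewrite -(kmap_diff _ sop_embed); apply: inJ_embed.
exists (kmap restrict g); have := inJ_restrict Jg.
rewrite kmapB (kmap_diff _ sop_restrict) kdiff_induced.
by rewrite [kmap restrict (kmap _ _)](_ : _ = u) //; apply/ffunP=> T; rewrite !ffunE embedK.
Qed.

Lemma induced_exact q : exact sop theta_ix (I_ D) q -> exact sop theta_ix (I_ D) q.+1 ->
  exact sopA theta_ix (I_ DA) q.+1.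
Proof.
move=> ex0 ex1; rewrite -colorU1; apply: exact_add => //; first exact: color_notin.
  exact: induced_exact_colors.
exact: induced_exact_colors.
Qed.

(** The hypothesis makes the color sum of [i] act injectively on H_q, by [exact_inj]; but it is 0 on
    the induced complex. *)
Lemma induced_exact_del q : exact sopA theta_ix (I_ DA) q.+1 -> exact sopA X0 (I_ DA) q.
Proof.
move=> ex w Kw Jw; apply: (exact_inj (a := a) idIA color_notin _ Kw Jw); first by rewrite colorU1.
by rewrite /= theta_induced0; apply: bnd_scale_J => //; apply: ideal0.
Qed.

(* The part of a cycle whose monomials have no vertex of color [i] comes from the
   induced complex. *)
Lemma remove_color p f : exact sopA X0 (I_ DA) p ->
  kin theta_ix p f -> inJ (I_ D) (kdiff sop theta_ix f) ->
  bnd sop theta_ix (I_ D)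
    (f - kfilter (fun T m => (a \in T) || (i \in c @: mvert m)) f).
Proof.
(* [ann a] after [cre a] keeps the coefficients of [f] at the sets avoiding [a], and [restrict]
   keeps their monomials without color [i]. *)
move=> ex Kf Jf; pose f0 := ann a (cre a f); pose u := kmap restrict f0.
have Kf0 : kin X0 p f0 by apply: kin_ann; apply: kin_cre_in => //; apply: inl_theta_ix.
have [|g [Kg Jg]] := @bnd_kin _ _ sopA X0 (I_ DA) p u idIA (kin_kmap restrict Kf0).
  apply: ex; first exact: kin_kmap.
  have E : kdiff sop X0 f0 = ann a (cre a (kdiff sop X0 f)).
    by rewrite /f0 kdiff_ann kdiff_creC ?color_notin // raddfN opprK.
  rewrite -(kmap_diff (h := restrict) (s := sop)); last first.
    by move=> j /setD1P[_]; apply: sop_restrict.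
  have F : kmap restrict (ann a (cre a (kdiff sop theta_ix f))) = kmap restrict (kdiff sop X0 f0).
    have K := kdiffU1 sop f color_notin; rewrite colorU1 in K.
    rewrite E K [cre a (_ + _)]raddfD [ann a (_ + _)]raddfD /= cre_scale ann_scale.
    rewrite kmapD kmap_scale /= restrict_theta theta_induced0.
    have -> g : kscale 0 g = 0 :> kchain SA ('I_d + 'I_d)%type.
      by apply/ffunP=> T; rewrite !ffunE mul0r.
    by rewrite add0r.
  by rewrite -F; exact: inJ_restrict (inJ_ann idI _ (inJ_cre idI _ Jf)).
exists (kmap embed g); have := inJ_embed Jg.
rewrite kmapB (kmap_diff _ sop_embed) -kdiff_free; last first.
  exact: ann_notin color_notin (kin_kmap embed Kg).
move=> Je T m mD; have := Je T m mD.
have subE (g1 h : kchain S ('I_d + 'I_d)%type) : (g1 - h) T = g1 T - h T by rewrite !ffunE.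
rewrite !subE !mcoeffB; apply: etrans; congr (_ - _).
rewrite [kmap embed u T]ffunE [u T]ffunE mcoeff_embed_restrict ann_creE ffunE mcoeff_filter.
have -> : (i \in c @: mvert m) = ~~ (mvert m \subset A).
  apply/imsetP/subsetPn => [[v vm iv]|[v vm]]; first by exists v; rewrite ?memA -?iv ?eqxx.
  by rewrite memA negbK => /eqP <-; exists v.
by case: (a \in T) => /=; case: (mvert m \subset A); rewrite ?mcoeff0 ?subrr ?subr0.
Qed.

End InducedComplex.

(** * Balanced complexes and the choice of the color *)

Section Balanced.
Variables (k : fieldType) (V : finType) (d : nat) (D : complex V).

Lemma balanced_coloring (P : 'I_d -> {set V}) : balanced D P ->
  exists c : V -> 'I_d, rainbow c (faces D) /\ forall v i, (v \in P i) = (c v == i).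
Proof.
case=> _ Pinj /and3P[/eqP cov /trivIsetP triv _] bal.
have /fin_all_exists[c cP] v : exists i, v \in P i.
  have : v \in cover [set P i | i : 'I_d] by rewrite cov inE.
  by case/bigcupP=> _ /imsetP[i _ ->] vi; exists i.
have memP v i : (v \in P i) = (c v == i).
  apply/idP/eqP => [vi|<- //]; apply: Pinj; apply: contraTeq (cP v) => ne.
  have := triv (P (c v)) (P i) (imset_f _ isT) (imset_f _ isT) ne.
  by move/disjointFl => /(_ v vi) ->.
exists c; split=> // F FD u v uF vF cuv.
by apply: (card_le1_eqP (bal F (c u) FD)); rewrite inE ?uF ?vF memP ?cuv ?eqxx.
Qed.

Variable c : V -> 'I_d.
Local Notation theta_ix := (theta_ix d).
Local Notation sopA i := (sop k (fun w : {v : V | v \in ~: [set v | c v == i]} => c (val w))).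
Local Notation sop := (sop k c).
Local Notation I_ D := (@monomial_ideal k _ (faces D)).
Hypothesis rb : rainbow c (faces D).

Let idI : is_ideal (I_ D).
Proof. by apply: monomial_ideal_ideal; apply: complex_down_closed. Qed.

Definition color_class i : {set V} := [set v | c v == i].

Lemma exact_from_induced p : (p <= d)%N ->
  (forall h : reduced_homology k D ((d - p)%N%:Z - 1), h = 0) ->
  (forall i, exact (sopA i) (theta_ix :\ inl i)
     (I_ (induced D (~: color_class i))) p) ->
  exact sop theta_ix (I_ D) p.
Proof.
move=> pd H0 exA f Kf Jf; have dc := complex_down_closed (D := D).
(* First the exponent of each vertex is made at most 1, and 0 if its color lies in [T]. *)
have [|] := @reduce_vertices _ _ _ c _ true (enum V) p f dc rb _ Kf Jf => //.
set f1 := kfilter _ f => g1 Jg1; have b1 : bnd sop theta_ix (I_ D) (f - f1) by exists g1.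
have Kf1 : kin theta_ix p f1 by apply: kin_kfilter.
have Jf1 := bnd_cycle dc b1 Jf.
(* Next, for each color, the terms are dropped in which it occurs neither in [T] nor in the
   monomial. *)
have step i g : i \in enum 'I_d -> kin theta_ix p g -> inJ (I_ D) (kdiff sop theta_ix g) ->
    bnd sop theta_ix (I_ D)
      (g - kfilter (fun T m => (inl i \in T) || (i \in c @: mvert m)) g).
  move=> _; apply: (@remove_color _ _ _ c D i (~: color_class i)); last exact: exA.
  by move=> v; rewrite !inE.
have b2 := kfilter_seq dc step Kf1 Jf1.
move: b2; set f2 := kfilter _ f1 => b2.
suff b3 : bnd sop theta_ix (I_ D) f2.
  have -> : f = (f - f1) + ((f1 - f2) + f2) by rewrite !subrK.
  by apply: bndD => //; apply: bndD.
apply: (strand_exact rb pd H0); first by apply: kin_kfilter.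
  exact: bnd_cycle dc b2 Jf1.
move=> T m mD; rewrite ffunE mcoeff_filter; case: ifP => [/allP Tcol|]; last by rewrite eqxx.
rewrite ffunE mcoeff_filter; case: ifP => [/allP mT|]; last by rewrite eqxx.
move=> nz; have {}Tcol i : (inl i \in T) || (i \in c @: mvert m).
  by apply: Tcol; rewrite mem_enum.
have {}mT v : (mexp m v < 1 + (inl (c v) \notin T))%N by apply: mT; rewrite mem_enum.
have Tth : T \subset theta_ix.
  by apply: contraNT nz => nT; rewrite Kf ?mcoeff0 // (negPf nT).
split.
  apply: mexpP => v; rewrite mexp_face inE.
  by have := mT v; case: (mexp m v) => [|[|e]] //; case: (_ \notin _).
apply/setP=> -[j|j]; last first.
  apply/idP/idP => [/(subsetP Tth)/theta_ixP[] //|].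
  by case/(subsetP (missing_sub _ _))/theta_ixP.
rewrite mem_missing; have := Tcol j; case: (boolP (j \in c @: mvert m)) => /=; last by rewrite orbF.
case/imsetP=> v vm -> _; apply/negbTE/negP => vT.
by have := mT v; rewrite vT addn0 ltnS leqn0; rewrite inE in vm; rewrite (negPf vm).
Qed.

Lemma exists_top_exact : exists p, [/\ (p <= d)%N, ~ exact sop theta_ix (I_ D) p
  & forall q, (p < q)%N -> exact sop theta_ix (I_ D) q].
Proof.
pose Q p := boolp.asbool (~ exact sop theta_ix (I_ D) p).
have Q0 : exists p, Q p by exists 0%N; apply/boolp.asboolP/not_exact0.
have Qd p : Q p -> (p <= d)%N.
  move/boolp.asboolP => nex; rewrite leqNgt; apply/negP => dp; apply: nex.
  by apply: exact_gt => //; rewrite card_theta_ix.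
case: (ex_maxnP Q0 Qd) => p Qp pmax; exists p; split; first exact: Qd.
  exact/boolp.asboolP.
move=> q pq; apply: boolp.contrapT => nq; move: pq.
by rewrite ltnNge => /negP; apply; apply: pmax; apply/boolp.asboolP.
Qed.

(** Let [p] be the top non-vanishing degree for [D]. Some induced complex has non-zero H_p over the
    colors other than [i]; its color sum of [i] is 0, so over all [d] colors the class persists in
    degree [p.+1], which is then the top degree. *)
Lemma depth_induced : 
  (forall h : reduced_homology k D ((SR_depth k D)%:Z - 1), h = 0) ->
  exists i, (SR_depth k (induced D (~: color_class i)))%:Z = (SR_depth k D)%:Z - 1.
Proof.
have [p [pd nex ex]] := exists_top_exact.
rewrite (SR_depth_eq rb pd nex ex) => H0.
have [i ni] : exists i, ~ exact (sopA i) (theta_ix :\ inl i)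
     (I_ (induced D (~: color_class i))) p.
  apply: boolp.contrapT => nE; apply: nex; apply: exact_from_induced => // i.
  by apply: boolp.contrapT => ni; apply: nE; exists i.
exists i; have memA v : (v \in ~: color_class i) = (c v != i) by rewrite !inE.
have rbA := rainbow_induced (A := ~: color_class i) rb.
have nexA : ~ exact (sopA i) theta_ix (I_ (induced D (~: color_class i))) p.+1.
  by move=> exA; apply: ni; apply: induced_exact_del.
have pd' : (p < d)%N.
  rewrite ltnNge; apply/negP => dp; apply: nexA; apply: exact_gt.
    by apply: monomial_ideal_ideal; apply: complex_down_closed.
  by rewrite card_theta_ix.
rewrite (SR_depth_eq rbA pd' nexA).
  have -> : (d - p = d - p.+1 + 1)%N by rewrite addn1 subnSK.
  by rewrite PoszD addrK.
by case=> // q pq; apply: induced_exact => //; apply: ex => //; apply: ltnW.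
Qed.

End Balanced.

Theorem proposition1p5 (k : fieldType) (V : finType) (d : nat) (D : complex V)
    (P : 'I_d -> {set V}) :
  balanced D P ->
  (forall h : reduced_homology k D ((SR_depth k D)%:Z - 1), h = 0) ->
  exists i : 'I_d,
    (SR_depth k (induced D (~: P i)))%:Z = (SR_depth k D)%:Z - 1.
Proof.
case/balanced_coloring=> c [rb Pc] H0; have [i Di] := depth_induced rb H0.
exists i; suff -> : P i = color_class c i by [].
by apply/setP=> v; rewrite Pc inE.
Qed.
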